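(* There exist universal positive constants $c$, $c'$, $L_0$, $q_0$ and $n_0$ such that the following holds for any $L\geq L_0$, any $q>q_0$ and any $n>n_0$. There exists $\kappa_L>0$ (only depending on $L$) such that for any integer $K>0$ and any $\theta\in\Theta_K$, the event $\mathcal{A}_q$ has probability higher than $1-ce^{-c'q}$ and, on $\mathcal{A}_q$, the penalized least-squares estimator $\widehat\tau$ (with tuning parameters $L$, $q$) satisfies: (a) No spurious change-point is detected: $$\left|\{\widehat\tau\}\cap\left(\tfrac{\tau^*_{k-1}+\tau^*_k}{2},\tfrac{\tau^*_k+\tau^*_{k+1}}{2}\right]\right|\leq1\ \text{ for all }k\in\{2,\dots,K-1\},\quad \left|\{\widehat\tau\}\cap\left[2,\tfrac{\tau_1^*+\tau_2^*}{2}\right]\right|\leq1,\quad\left|\{\widehat\tau\}\cap\left(\tfrac{\tau^*_{K-1}+\tau^*_K}{2},n\right]\right|\leq1.$$ (b) High-energy change-points are detected: for all $k\in\{1,\dots,K\}$ such that $\tau_k^*$ is a $(\kappa_L,q)$-high-energy change-point, $$d_{H,1}(\widehat\tau,\tau_k^* )\leq\min\left\{\frac{\tau^*_{k+1}-\tau^*_k}{2},\ \frac{\tau^*_k-\tau^*_{k-1}}{2},\ \kappa_L\frac{\log(n\Delta_k^2)+q}{\Delta_k^2}\right\}.$$ (c) For all $k\in\{1,\dots,K\}$, either $\tau_k^*$ belongs to $\widehat\tau$ or it is not a $(\sqrt{L}+2,q,\widehat\tau^{(k)})$-high-energy change-point.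
   Context: Model: $Y_i=\theta_i+\epsilon_i$, $i=1,\dots,n$, where $\epsilon_1,\dots,\epsilon_n$ are independent, mean-zero and satisfy $\mathbb{E}[e^{t\epsilon_i}]\leq e^{t^2/2}$ for all $t\in\mathbb{R}$. $\Theta_K\subset\mathbb{R}^n$ is the set of vectors with exactly $K$ change-points: there are integers $1=\tau_0^*<\tau_1^*<\dots<\tau_K^*<\tau_{K+1}^*=n+1$ and reals $\mu_1,\dots,\mu_{K+1}$ with $\mu_k\neq\mu_{k+1}$ and $\theta_i=\mu_k$ for $\tau_{k-1}^*\leq i<\tau_k^*$; $\Delta_k=\mu_{k+1}-\mu_k$. $\mathcal{T}_3$ is the set of integer triplets $t=(t_1,t_2,t_3)$ with $1\leq t_1<t_2<t_3\leq n+1$. For such $t$ write $S(t)=\sqrt{\frac{(t_2-t_1)(t_3-t_2)}{t_3-t_1}}$ and $$E(\theta,t)=\left|\frac{\sum_{i=t_2}^{t_3-1}\theta_i}{t_3-t_2}-\frac{\sum_{i=t_1}^{t_2-1}\theta_i}{t_2-t_1}\right|S(t),\qquad N(t)=\left[\frac{\sum_{i=t_2}^{t_3-1}\epsilon_i}{t_3-t_2}-\frac{\sum_{i=t_1}^{t_2-1}\epsilon_i}{t_2-t_1}\right]S(t).$$ The event $\mathcal{A}_q$ is $\left\{|N(t)|\leq2\sqrt{2\log\left(\frac{n(t_3-t_1)}{(t_3-t_2)(t_2-t_1)}\right)+q}\ \ \forall t\in\mathcal{T}_3\right\}$. A change-point vector is a (possibly empty) strictly increasing vector $\tau=(\tau_1,\dots,\tau_{|\tau|})$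 of integers in $\{2,\dots,n\}$, with the convention $\tau_0=1$, $\tau_{|\tau|+1}=n+1$; $\{\tau\}$ is the set of its entries, and $d_{H,1}(\tau,\tau')=\min_i|\tau_i-\tau'|$ ($+\infty$ if $\tau$ is empty). $\Pi_\tau$ is the orthogonal projection onto the vectors constant on each $\{\tau_i,\dots,\tau_{i+1}-1\}$, $i=0,\dots,|\tau|$. The penalized least-squares estimator $\widehat\tau$ is any minimizer over all change-point vectors of $$\mathrm{Cr}_0(Y,\tau)=\|Y-\Pi_\tau Y\|^2+L\left[q|\tau|+2\sum_{i=1}^{|\tau|+1}\log\left(\frac{n}{\tau_i-\tau_{i-1}}\right)\right].$$ For $\kappa>0$, an entry $\tau_l$ of a change-point vector $\tau$ is a $(\kappa,q,\tau)$-high-energy change-point if $E(\theta,(\tau_{l-1},\tau_l,\tau_{l+1}))>\kappa\sqrt{2\log\left(\frac{n(\tau_{l+1}-\tau_{l-1})}{(\tau_{l+1}-\tau_l)(\tau_l-\tau_{l-1})}\right)+q}$. A true change-point $\tau_k^*$ is $(\kappa,q)$-high-energy if this holds with $\tau=\tau^*$, $l=k$ (then $E(\theta,(\tau^*_{k-1},\tau^*_k,\tau^*_{k+1}))=|\Delta_k|\sqrt{\frac{(\tau^*_k-\tau^*_{k-1})(\tau^*_{k+1}-\tau^*_k)}{\tau^*_{k+1}-\tau^*_{k-1}}}$). For a change-point vector $\tau$, $\tau^{(k)}$ is the reordered concatenation of $\tau$ and $\tau_k^*$. *)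

(* Defs.v *)
From HB Require Import structures.
From mathcomp Require Import all_boot all_order all_algebra.
From mathcomp Require Import all_classical all_reals all_analysis.

Set Implicit Arguments.
Unset Strict Implicit.
Unset Printing Implicit Defensive.

Import Order.TTheory GRing.Theory Num.Theory.
Import numFieldNormedType.Exports.

Local Open Scope classical_set_scope.
Local Open Scope ring_scope.

(* Positions are natural numbers in {1, ..., n}, whereas row vectors are
   indexed by 'I_n = {0, ..., n-1}: column i of a vector holds its entry of
   position i.+1. *)

Section ChangePointVectors.
Variable n : nat.

Definition is_cpvec (tau : seq nat) : bool :=
  sorted ltn tau && all (fun t => 2 <= t <= n)%N tau.

(* cpt tau 0 = 1, cpt tau l is the l-th entry of tau for 1 <= l <= |tau|,
   and cpt tau (|tau| + 1) = n + 1. *)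
Definition cpt (tau : seq nat) (l : nat) : nat := nth n.+1 (1%N :: tau) l.

Definition in_seg (tau : seq nat) (l : nat) (i : 'I_n) : bool :=
  (cpt tau l <= i.+1 < cpt tau l.+1)%N.

Definition in_T3 (t1 t2 t3 : nat) : bool :=
  [&& 1 <= t1, t1 < t2, t2 < t3 & t3 <= n.+1]%N.

End ChangePointVectors.

Definition insert_cpt (tau : seq nat) (t : nat) : seq nat :=
  sort leq (rcons tau t).

Section Deterministic.
Variables (R : realType) (n : nat).
Implicit Types (v theta : 'rV[R]_n) (tau : seq nat).

(* Over positions a, ..., b - 1. *)
Definition seg_mean v (a b : nat) : R :=
  (\sum_(i < n | (a <= i.+1 < b)%N) v 0 i) / (b - a)%N%:R.

Definition scale (t1 t2 t3 : nat) : R :=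
  Num.sqrt (((t2 - t1) * (t3 - t2))%N%:R / (t3 - t1)%N%:R).

Definition energy theta (t1 t2 t3 : nat) : R :=
  `|seg_mean theta t2 t3 - seg_mean theta t1 t2| * scale t1 t2 t3.

Definition noise_stat v (t1 t2 t3 : nat) : R :=
  (seg_mean v t2 t3 - seg_mean v t1 t2) * scale t1 t2 t3.

Definition log_threshold (q : R) (t1 t2 t3 : nat) : R :=
  Num.sqrt (2 * ln ((n * (t3 - t1))%N%:R / ((t3 - t2) * (t2 - t1))%N%:R) + q).

(* About the l-th entry of tau, counted from 1. *)
Definition high_energy theta (kappa q : R) tau (l : nat) : bool :=
  let t1 := cpt n tau l.-1 in
  let t2 := cpt n tau l in
  let t3 := cpt n tau l.+1 in
  kappa * log_threshold q t1 t2 t3 < energy theta t1 t2 t3.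

(* theta has exactly the K change-points listed in taus, with successive values
   mu 1, ..., mu K.+1; the other values of mu are irrelevant. *)
Definition in_Theta (K : nat) theta (taus : seq nat) (mu : nat -> R) : Prop :=
  [/\ is_cpvec n taus,
      size taus = K,
      forall k : nat, (1 <= k <= K)%N -> mu k != mu k.+1
    & forall k : nat, (1 <= k <= K.+1)%N ->
        forall i : 'I_n, in_seg taus k.-1 i -> theta 0 i = mu k].

Definition jump (mu : nat -> R) (k : nat) : R := mu k.+1 - mu k.

Definition dotv (u v : 'rV[R]_n) : R := \sum_(i < n) u 0 i * v 0 i.

Definition sqnorm v : R := dotv v v.

Definition piecewise_constant tau : set 'rV[R]_n :=
  [set v | forall l : nat, (l <= size tau)%N ->
     forall i j : 'I_n, in_seg tau l i -> in_seg tau l j -> v 0 i = v 0 j].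

Definition is_orth_proj (V : set 'rV[R]_n) (y p : 'rV[R]_n) : Prop :=
  V p /\ forall v, V v -> dotv (y - p) v = 0.

(* The orthogonal projection of y always exists and is unique, since
   piecewise_constant tau is a linear subspace of R^n: the default value 0 of
   xget is never used. *)
Definition orth_proj tau (y : 'rV[R]_n) : 'rV[R]_n :=
  xget 0 [set p | is_orth_proj (piecewise_constant tau) y p].

Definition Cr0 (L q : R) (y : 'rV[R]_n) tau : R :=
  sqnorm (y - orth_proj tau y) +
  L * (q * (size tau)%:R +
       2 * \sum_(1 <= i < (size tau).+2)
             ln (n%:R / (cpt n tau i - cpt n tau i.-1)%N%:R)).

Definition is_pls_estimate (L q : R) (y : 'rV[R]_n) tau : Prop :=
  is_cpvec n tau /\
  forall tau', is_cpvec n tau' -> Cr0 L q y tau <= Cr0 L q y tau'.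

End Deterministic.

Section Distances.
Variable R : realType.

Definition dH1 (tau : seq nat) (t : nat) : \bar R :=
  \big[Order.min/+oo%E]_(s <- tau) (`|s%:R - t%:R : R|)%:E.

(* For a strictly increasing tau, the cardinality of {tau} intersected with I. *)
Definition count_in (tau : seq nat) (I : interval R) : nat :=
  count (fun s : nat => (s%:R : R) \in I) tau.

Definition midpoint (a b : nat) : R := (a + b)%N%:R / 2.

End Distances.

Section Noise.
Variables (R : realType) (d : measure_display) (T : measurableType d).
Variables (P : probability T R) (n : nat) (eps : 'I_n -> {RV P >-> R}).

Definition mutually_independent : Prop :=
  forall (J : {set 'I_n}) (B : 'I_n -> set R),
    (forall i, measurable (B i)) ->
    P (\bigcap_(i in [set i | i \in J]) (eps i @^-1` B i)) =
    (\prod_(i in J) P (eps i @^-1` B i))%E.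

Definition subgaussian_noise : Prop :=
  [/\ mutually_independent,
      forall i, P.-integrable setT (EFin \o eps i) /\ ('E_P[eps i] = 0)%E
    & forall i (t : R), ('M_P (eps i) t <= (expR (t ^+ 2 / 2))%:E)%E].

Definition noise_vec (w : T) : 'rV[R]_n := \row_i eps i w.

Definition eventA (q : R) : set T :=
  [set w | forall t1 t2 t3 : nat, in_T3 n t1 t2 t3 ->
     `|noise_stat (noise_vec w) t1 t2 t3| <= 2 * log_threshold n q t1 t2 t3].

End Noise.

(* Main.v *)
Require Import Defs.
From HB Require Import structures.
From mathcomp Require Import all_boot all_order all_algebra.
From mathcomp Require Import all_classical all_reals all_analysis.
From mathcomp Require Import measurable_realfun ring lra zify.

Set Implicit Arguments.
Unset Strict Implicit.
Unset Printing Implicit Defensive.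

Import Order.TTheory GRing.Theory Num.Theory.
Import numFieldNormedType.Exports.

Local Open Scope classical_set_scope.
Local Open Scope ring_scope.

(** Why the theorem holds.

    The noise event. A contrast of the noise at (t1, t2, t3) is a combination
    of the increments of the partial sums of the noise over [t1, t2) and
    [t2, t3), so that it is enough to bound every increment over l positions
    by sqrt (2 l (2 ln (n / l) + q)) ([noise_stat_le]).  There are about n ^ 2
    increments, too many for a union bound.  For each i, the increments between
    multiples of 2 ^ i that are at most 2 ^ (s + 1) blocks apart number only
    about 2 ^ (s + 1) n / 2 ^ i, and each one exceeds the slightly smaller
    threshold of level i with probability about
    (2 ^ i / n) ^ (3 / 2) exp (- 3 q / 4), which can be summed over all of them
    ([bad_event_prob]).  An arbitrary increment is one of these plus two
    remainders, and the remainders are telescoped along coarser and coarser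
    dyadic roundings; they are small because 2 ^ i is a tiny fraction of l
    ([chaining_bound]).  The tail of one increment is Chernoff's
    bound, where independence, stated for events only, is first extended to
    products of nonnegative functions ([expectation_prod_indep]).

    Minimality of the estimate.  Up to a constant, the criterion is the sum over
    consecutive entries a < b of 1 :: tau ++ [:: n + 1] of a cost of [a, b).
    Hence the estimate is also optimal between any two of its entries
    ([local_minimality]).  Deleting or inserting an entry t between the
    neighbours p and r changes the residual sum of squares by the squared
    contrast of the data at (p, t, r), and the penalty by exactly L times the
    squared threshold at (p, t, r) ([seg_cost_split]).  Insertion gives
    the third claim at once ([undetected_not_high_energy]); deletion shows that
    the estimated entries have a large signal contrast.

    No spurious change-point.  Moving an entry a to t between the neighbours p
    and r is not profitable either.  Since L and q are large, the noise and the
    penalty cost only a small fraction of the contrast at a, and one gets an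
    inequality that only involves the signal ([swap_bridge]): with F the partial
    sums of theta centred to vanish at p and r, F a is not 0 and
    F t ^ 2 <= (1 + small) (g t / g a + small) F a ^ 2,  where
    g t = (t - p) (r - t).  Suppose now that two consecutive entries lie in the
    cell of the same true change-point.  As F is affine on the plateaus of
    theta, moving one of the two entries to an end of the plateau that contains
    it violates this inequality.  If the other end of that plateau reaches p or
    r, then F vanishes there and one candidate is enough ([simple_swap]);
    otherwise one of the two ends must do ([complex_swap]).  The midpoint
    condition on cells makes these ends far enough from the entry.

    Detection.  If no entry lies within D of a true change-point t, insert t
    together with t - m and t + m, where m is of order D.  The penalty grows by
    at most a multiple of L (q + ln (n / m)), and the squared contrast of theta
    at (t - m, t, t + m) is jump ^ 2 * m / 2 because m stays within the plateaus.  So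
    jump ^ 2 * m <= 32 (L + 1) (q + ln (n / m)) ([window_jump]), which
    contradicts the high energy of t when m is of the order of the distance to
    the adjacent true change-points, and contradicts the definition of the rate
    when D is the claimed rate. *)

(** * Partial sums, contrasts and thresholds *)

Section PartialSums.
Context (R : realType) (n : nat).
Implicit Types v : 'rV[R]_n.

Definition psum v (t : nat) : R := \sum_(i < n | (i.+1 < t)%N) v 0 i.

Lemma psum1 v : psum v 1 = 0.
Proof. by apply: big_pred0 => i. Qed.

Lemma psum_seg v a b : (a <= b)%N ->
  \sum_(i < n | (a <= i.+1 < b)%N) v 0 i = psum v b - psum v a.
Proof.
move=> ab; apply/eqP; rewrite eq_sym subr_eq addrC; apply/eqP.
rewrite /psum (bigID (fun i : 'I_n => (i.+1 < a)%N))/=; congr (_ + _); apply: eq_bigl => i; lia.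
Qed.

Lemma psum_const (c : R) t : (1 <= t <= n.+1)%N -> psum (const_mx c) t = t.-1%:R * c.
Proof.
case: t => // t tn; rewrite /psum/= mulr_natl.
under eq_bigr do rewrite mxE; under eq_bigl do rewrite ltnS.
by rewrite -(big_ord_widen n (fun=> c)) ?sumr_const ?card_ord//; lia.
Qed.

Lemma sum1_seg a b : (1 <= a <= b)%N -> (b <= n.+1)%N ->
  \sum_(i < n | (a <= i.+1 < b)%N) 1 = (b - a)%N%:R :> R.
Proof.
move=> ab bn; have := @psum_seg (const_mx 1) a b.
under eq_bigr do rewrite mxE; move=> ->; last by case/andP: ab.
rewrite !psum_const ?mulr1; [|lia|lia].
by rewrite -natrB; [congr (_%:R); lia|lia].
Qed.

Lemma seg_meanE v a b : (a <= b)%N ->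
  seg_mean v a b = (psum v b - psum v a) / (b - a)%N%:R.
Proof. by move=> ab; rewrite /seg_mean psum_seg. Qed.

(** The partial sums of v, recentred so as to vanish at a and b.  Up to a
    factor that depends on (a, t, b) only, this is the contrast at t; unlike
    the contrast it is affine in t wherever v is constant. *)
Definition bridge v (a t b : nat) : R :=
  psum v t - psum v a - (t - a)%N%:R / (b - a)%N%:R * (psum v b - psum v a).

Lemma noise_statE v a t b : (a < t < b)%N ->
  noise_stat v a t b = - (bridge v a t b * (b - a)%N%:R /
    ((t - a)%N%:R * (b - t)%N%:R)) * scale R a t b.
Proof.
move=> /andP[at_ tb]; rewrite /noise_stat !seg_meanE ?(ltnW at_) ?(ltnW tb)//; congr (_ * _).
rewrite /bridge; have -> : (b - a = (t - a) + (b - t))%N by lia.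
rewrite natrD.
have : 0 < (t - a)%N%:R :> R by rewrite ltr0n subn_gt0.
have : 0 < (b - t)%N%:R :> R by rewrite ltr0n subn_gt0.
move: ((t - a)%N%:R : R) ((b - t)%N%:R : R) => x y y0 x0.
by field; rewrite !gt_eqF// addr_gt0.
Qed.

Lemma scale_ge0 a t b : 0 <= scale R a t b.
Proof. exact: sqrtr_ge0. Qed.

Lemma energyE v a t b : energy v a t b = `|noise_stat v a t b|.
Proof. by rewrite /energy /noise_stat normrM (ger0_norm (scale_ge0 _ _ _)). Qed.

Lemma noise_statD u v a t b :
  noise_stat (u + v) a t b = noise_stat u a t b + noise_stat v a t b.
Proof.
have meanD c e : seg_mean (u + v) c e = seg_mean u c e + seg_mean v c e.
  rewrite /seg_mean -mulrDl -big_split/=; congr (_ / _).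
  by apply: eq_bigr => i _; rewrite mxE.
by rewrite /noise_stat !meanD; ring.
Qed.

Lemma noise_stat_sqr v a t b : (a < t < b)%N ->
  noise_stat v a t b ^+ 2 =
  bridge v a t b ^+ 2 * (b - a)%N%:R / ((t - a)%N%:R * (b - t)%N%:R).
Proof.
move=> atb; have /andP[at_ tb] := atb; rewrite noise_statE// exprMn sqrrN sqr_sqrtr//.
rewrite natrM.
have : 0 < (t - a)%N%:R :> R by rewrite ltr0n subn_gt0.
have : 0 < (b - t)%N%:R :> R by rewrite ltr0n subn_gt0.
have : 0 < (b - a)%N%:R :> R by rewrite ltr0n subn_gt0 (ltn_trans at_).
by move=> z y x; field; rewrite !gt_eqF.
Qed.

(** The first equation is the reason why the penalty of the criterion and the
    threshold match: it is the variation of the penalty, divided by L, when t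
    is inserted between a and b. *)
Lemma log_threshold_sqr (q : R) a t b : 0 <= q -> (a < t < b)%N -> (b - a <= n)%N ->
  log_threshold n q a t b ^+ 2 = q + 2 * (ln (n%:R / (t - a)%N%:R) + ln (n%:R / (b - t)%N%:R)
                          - ln (n%:R / (b - a)%N%:R)) /\
  [/\ q <= log_threshold n q a t b ^+ 2,
   2 * ln (n%:R / (t - a)%N%:R) + q <= log_threshold n q a t b ^+ 2 &
   2 * ln (n%:R / (b - t)%N%:R) + q <= log_threshold n q a t b ^+ 2].
Proof.
move=> q0 /andP[at_ tb] ban.
set X := ln (n%:R / (t - a)%N%:R); set Y := ln (n%:R / (b - t)%N%:R).
set Z := ln (n%:R / (b - a)%N%:R).
have ab := ltn_trans at_ tb.
have n0 : 0 < n%:R :> R by rewrite ltr0n; apply: leq_trans ban; rewrite subn_gt0.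
have p1 : 0 < (t - a)%N%:R :> R by rewrite ltr0n subn_gt0.
have p2 : 0 < (b - t)%N%:R :> R by rewrite ltr0n subn_gt0.
have p3 : 0 < (b - a)%N%:R :> R by rewrite ltr0n subn_gt0.
have Z0 : 0 <= Z by apply: ln_ge0; rewrite ler_pdivlMr// mul1r ler_nat.
have ZX : Z <= X.
  rewrite ler_ln ?posrE ?divr_gt0// ler_pM2l// lef_pV2 ?posrE// ler_nat; lia.
have ZY : Z <= Y.
  rewrite ler_ln ?posrE ?divr_gt0// ler_pM2l// lef_pV2 ?posrE// ler_nat; lia.
have -> : log_threshold n q a t b ^+ 2 = q + 2 * (X + Y - Z).
  have E : ln ((n * (b - a))%N%:R / ((b - t) * (t - a))%N%:R) = X + Y - Z.
    rewrite -lnM ?posrE ?divr_gt0// -ln_div ?posrE ?divr_gt0 ?mulr_gt0 ?invr_gt0//.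
    by congr ln; rewrite !natrM; field; rewrite !gt_eqF.
  rewrite sqr_sqrtr E; first by ring.
  by lra.
by split; [lra|split; lra].
Qed.

End PartialSums.

(** * Moment generating function of a sum of independent variables *)

Section IntegralTransfer.
Import HBNNSimple.
Context d (T : measurableType d) d' (T' : measurableType d') (R : realType)
  (P : {measure set T -> \bar R}).
Local Open Scope ereal_scope.

Lemma monotone_convergence_to (f : T -> R) (f_ : nat -> T -> R) :
  (forall m, measurable_fun setT (f_ m)) -> (forall m w, (0 <= f_ m w)%R) ->
  (forall w, nondecreasing_seq (f_ ^~ w)) ->
  (forall w, (f_ m w)%:E @[m --> \oo] --> (f w)%:E) ->
  \int[P]_w (f_ m w)%:E @[m --> \oo] --> \int[P]_w (f w)%:E.
Proof.
move=> mf f0 ndf cvf.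
have -> : \int[P]_w (f w)%:E = \int[P]_w limn (fun m => (f_ m w)%:E).
  by apply: eq_integral => w _; apply/esym/cvg_lim => //; exact: cvf.
apply: cvg_monotone_convergence => //.
- by move=> m; apply/measurable_EFinP.
- by move=> m w _; rewrite lee_fin.
- by move=> w _ a b ab; rewrite lee_fin; exact: ndf.
Qed.

(** The hypothesis says that the law of X under the measure with density g is c
    times its law under P; both sides of the conclusion are then the integral of
    h against it.  The passage from indicators to h is by simple functions and
    monotone convergence. *)
Lemma integral_weight_transfer (X : T -> T') (g : T -> R) (c : \bar R)
    (h : T' -> R) :
  measurable_fun setT X -> measurable_fun setT g -> (forall w, (0 <= g w)%R) ->
  c \is a fin_num ->
  (forall B, measurable B ->
     \int[P]_w (\1_B (X w) * g w)%:E = P (X @^-1` B) * c) ->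
  measurable_fun setT h -> (forall x, (0 <= h x)%R) ->
  \int[P]_w (h (X w) * g w)%:E = (\int[P]_w (h (X w))%:E) * c.
Proof.
move=> mX mg g0 cfin HB mh h0.
have mEh : measurable_fun setT (EFin \o h) by apply/measurable_EFinP.
have h0' : forall x, setT x -> 0 <= (EFin \o h) x by move=> x _; rewrite lee_fin.
pose k := nnsfun_approx measurableT mEh.
have cvk x : (k m x)%:E @[m --> \oo] --> (h x)%:E.
  by apply: (cvg_nnsfun_approx measurableT mEh h0').
have ndk x : nondecreasing_seq (fun m => k m x).
  by move=> a b ab; exact/lefP/nd_nnsfun_approx.
have mkX m : measurable_fun setT (fun w => k m (X w)).
  by apply: measurableT_comp.
have E1 : \int[P]_w (k m (X w))%:E @[m --> \oo] --> \int[P]_w (h (X w))%:E.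
  exact: monotone_convergence_to.
have E2 : \int[P]_w (k m (X w) * g w)%:E @[m --> \oo] -->
          \int[P]_w (h (X w) * g w)%:E.
  apply: monotone_convergence_to.
  - by move=> m; apply: measurable_funM.
  - by move=> m w; rewrite mulr_ge0.
  - by move=> w a b ab; rewrite ler_wpM2r//; apply: ndk.
  - by move=> w; under eq_fun do rewrite EFinM; rewrite EFinM; apply: cvgeZr.
have key m : \int[P]_w (k m (X w) * g w)%:E = (\int[P]_w (k m (X w))%:E) * c.
  have mind y : measurable_fun setT (fun w => (y * \1_(k m @^-1` [set y]) (X w))%R).
    by apply: measurable_funM => //; apply: measurableT_comp.
  have -> : \int[P]_w (k m (X w))%:E =
     \int[P]_w (\sum_(y \in range (k m)) (y * \1_(k m @^-1` [set y]) (X w))%:E).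
    by apply: eq_integral => w _; rewrite fimfunE -fsumEFin.
  have -> : \int[P]_w (k m (X w) * g w)%:E =
     \int[P]_w (\sum_(y \in range (k m)) (y * \1_(k m @^-1` [set y]) (X w) * g w)%:E).
    apply: eq_integral => w _; rewrite {1}fimfunE fsumEFin//.
    by congr EFin; rewrite mulr_fsuml.
  have nn y w : (0 <= y * \1_(k m @^-1` [set y]) (X w) :> R)%R.
    by have := nnfun_muleindic_ge0 (k m) y (X w); rewrite -EFinM lee_fin.
  rewrite ge0_integral_fsum//; last 2 first.
  - by move=> y; apply/measurable_EFinP; apply: measurable_funM.
  - by move=> y w _; rewrite lee_fin mulr_ge0.
  rewrite ge0_integral_fsum//; last 2 first.
  - by move=> y; apply/measurable_EFinP.
  - by move=> y w _; rewrite lee_fin.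
  rewrite ge0_mule_fsuml; last first.
    by move=> y; apply: integral_ge0 => w _; rewrite lee_fin.
  apply: eq_fsbigr => y; rewrite inE => -[x _ yE].
  have y0 : (0 <= y)%R by rewrite -yE.
  have mB : measurable (k m @^-1` [set y]) by exact: measurable_funPTI.
  under eq_integral do rewrite -mulrA EFinM.
  rewrite ge0_integralZl_EFin//; last 2 first.
  - by move=> w _; rewrite lee_fin mulr_ge0.
  - apply/measurable_EFinP; apply: measurable_funM => //.
    exact: measurableT_comp.
  rewrite HB//.
  under [in RHS]eq_integral do rewrite EFinM.
  rewrite ge0_integralZl_EFin//; last first.
    by apply/measurable_EFinP; exact: measurableT_comp.
  rewrite -muleA; congr (_ * (_ * _)).
  rewrite (_ : (fun w => (\1_(k m @^-1` [set y]) (X w))%:E) = (fun w => (\1_(X @^-1` (k m @^-1` [set y])) w)%:E)) //.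
  rewrite integral_indic ?setIT//.
  by rewrite -[X in measurable X]setTI; exact: mX.
have E3 : \int[P]_w (k m (X w) * g w)%:E @[m --> \oo] -->
          (\int[P]_w (h (X w))%:E) * c.
  by under eq_fun do rewrite key; apply: cvgeZr.
by have := cvg_unique _ E2 E3; apply; exact: ereal_hausdorff.
Qed.

End IntegralTransfer.

Section ProductExpectation.
Context (R : realType) d (T : measurableType d) (P : probability T R) (n : nat).
Variable eps : 'I_n -> {RV P >-> R}.
Local Open Scope ereal_scope.

(** Independence is the case where all factors are indicators.  The factors are
    then replaced by arbitrary ones one coordinate at a time, with
    [integral_weight_transfer] where the weight is the product of the other
    factors. *)
Lemma expectation_prod_indep (f : 'I_n -> R -> R) :
  mutually_independent eps ->
  (forall i, measurable_fun setT (f i)) -> (forall i x, (0 <= f i x)%R) ->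
  (forall i, \int[P]_w (f i (eps i w))%:E < +oo) ->
  \int[P]_w (\prod_(i < n) f i (eps i w))%:E =
  \prod_(i < n) \int[P]_w (f i (eps i w))%:E.
Proof.
move=> ind.
have mPre i B : measurable B -> measurable (eps i @^-1` B).
  by move=> mB; exact: measurable_funPTI.
have intI i (B : set R) : measurable B ->
    \int[P]_w (\1_B (eps i w))%:E = P (eps i @^-1` B).
  by move=> mB; have := integral_indic P measurableT (mPre i B mB); rewrite setIT.
(* Only the first k factors are arbitrary. *)
suff H k : (k <= n)%N -> forall (g : 'I_n -> R -> R) (B : 'I_n -> set R),
    (forall i, measurable_fun setT (g i)) -> (forall i x, (0 <= g i x)%R) ->
    (forall i, \int[P]_w (g i (eps i w))%:E < +oo) ->
    (forall i, measurable (B i)) ->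
    (forall i : 'I_n, (k <= i)%N -> g i = \1_(B i)) ->
  \int[P]_w (\prod_(i < n) g i (eps i w))%:E =
  \prod_(i < n) \int[P]_w (g i (eps i w))%:E.
  move=> mf f0 finf; apply: (H n (leqnn n) f (fun=> setT)) => // i.
  by rewrite leqNgt ltn_ord.
elim: k => [_ g B _ _ _ mB gB|k IH kn g B mg g0 fing mB gB].
  under eq_integral => w _.
    rewrite (_ : (\prod_(i < n) g i (eps i w))%R =
       \1_(\bigcap_(i in [set i | i \in [set: 'I_n]%SET]) (eps i @^-1` B i)) w); last first.
      under eq_bigr => i _ do rewrite gB// indicE.
      rewrite indicE; case: (boolP (w \in _)) => [|].
        rewrite inE => wB; apply: big1 => i _.
        by rewrite mem_set//; apply: (wB i); rewrite /= finset.in_setT.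
      move/negP => wB.
      have [i /negbTE wi] : exists i, eps i w \notin B i.
        apply: contrapT => /forallNP nB; apply: wB; rewrite inE => i _ /=.
        by apply: set_mem; apply/negbNE/negP; exact: nB.
      by rewrite (bigD1 i)//= wi mul0r.
    over.
  rewrite integral_indic ?setIT//; last first.
    by apply: fin_bigcap_measurable => // i _; apply: mPre.
  apply: (etrans (ind [set: 'I_n]%SET B mB)); apply: eq_big => [i|i _]; first by rewrite finset.in_setT.
  by rewrite gB// intI.
pose i0 := Ordinal kn.
rewrite (bigD1 i0)//=.
under eq_integral do rewrite (bigD1 i0)//=.
apply: integral_weight_transfer => //.
- under eq_fun do rewrite -big_filter.
  by apply: measurable_prod => i _; exact: measurableT_comp.
- by move=> w; apply: prodr_ge0 => i _.
- apply: (big_ind (fun x => x \is a fin_num)) => // [x y|i _].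
    exact: fin_numM.
  by rewrite ge0_fin_numE//; apply: integral_ge0 => w _; rewrite lee_fin.
- move=> A mA.
  pose g' i := if i == i0 then \1_A : R -> R else g i.
  pose B' i := if i == i0 then A else B i.
  have := IH (ltnW kn) g' B'; rewrite (bigD1 i0)//=.
  have -> : \int[P]_w (g' i0 (eps i0 w))%:E = P (eps i0 @^-1` A).
    by rewrite /g' eqxx intI.
  have -> : \prod_(i < n | i != i0) \int[P]_w (g' i (eps i w))%:E =
            \prod_(i < n | i != i0) \int[P]_w (g i (eps i w))%:E.
    by apply: eq_bigr => i /negbTE ni; rewrite /g' ni.
  move=> <-.
  + apply: eq_integral => w _; rewrite [in RHS](bigD1 i0)//=.
    congr (_ * _)%:E; first by rewrite /g' eqxx.
    by apply: eq_bigr => i /negbTE ni; rewrite /g' ni.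
  + by move=> i; rewrite /g'; case: eqP.
  + by move=> i x; rewrite /g'; case: eqP => // _; rewrite indicE.
  + move=> i; rewrite /g'; case: eqP => // ->; rewrite intI//.
    by rewrite (le_lt_trans (probability_le1 _ _)) ?ltry//; exact: mPre.
  + by move=> i; rewrite /B'; case: eqP.
  + move=> i ki; rewrite /g' /B'; case: eqP => // /eqP ni; apply: gB.
    by rewrite ltn_neqAle ki andbT; apply: contra ni => /eqP ni; apply/eqP/val_inj.
Qed.

End ProductExpectation.

Section SubgaussianTail.
Context (R : realType) d (T : measurableType d) (P : probability T R) (n : nat).
Variable eps : 'I_n -> {RV P >-> R}.
Hypothesis sg : subgaussian_noise eps.
Local Open Scope ereal_scope.

Lemma subgaussian_mgf_sum (J : pred 'I_n) (t : R) :
  \int[P]_w (expR (t * \sum_(i < n | J i) eps i w))%:E <=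
  (expR (t ^+ 2 / 2 * (\sum_(i < n | J i) 1)))%:E.
Proof.
case: sg => ind _ mgf.
have {}mgf i (s : R) : \int[P]_w (expR (s * eps i w))%:E <= (expR (s ^+ 2 / 2))%:E.
  have := mgf i s; rewrite /mmt_gen_fun unlock.
  by under eq_integral do rewrite /= mulrC.
pose f i : R -> R := if J i then (fun x => expR (t * x)) else cst 1%R.
have fE i : \int[P]_w (f i (eps i w))%:E <= (if J i then expR (t ^+ 2 / 2) else 1%R)%:E.
  rewrite /f; case: (J i); first exact: mgf.
  by have /= -> := @integral_cst _ _ _ P _ measurableT 1; rewrite probability_setT mule1.
have -> : \int[P]_w (expR (t * \sum_(i < n | J i) eps i w))%:E =
    \int[P]_w (\prod_(i < n) f i (eps i w))%:E.
  apply: eq_integral => w _; rewrite mulr_sumr expR_sum big_mkcond/=.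
  by congr EFin; apply: eq_bigr => i _; rewrite /f; case: (J i).
rewrite expectation_prod_indep//; last 3 first.
- move=> i; rewrite /f; case: (J i) => //.
  apply: measurableT_comp => //; exact: measurable_funM.
- by move=> i x; rewrite /f; case: (J i) => //=; exact: expR_ge0.
- by move=> i; apply: le_lt_trans (fE i) _; rewrite ltry.
apply: (@le_trans _ _ (\prod_(i < n) (if J i then expR (t ^+ 2 / 2) else 1%R)%:E)).
  have : 0 <= \prod_(i < n) \int[P]_w (f i (eps i w))%:E /\
      \prod_(i < n) \int[P]_w (f i (eps i w))%:E <=
      \prod_(i < n) (if J i then expR (t ^+ 2 / 2) else 1%R)%:E.
    elim/big_rec2 : _ => [//|i x1 x2 _ [x0 x12]].
    have fi0 : 0 <= \int[P]_w (f i (eps i w))%:E.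
      apply: integral_ge0 => w _; rewrite lee_fin /f.
      by case: (J i) => //=; exact: expR_ge0.
    by split; [exact: mule_ge0|exact: lee_pmul].
  by case.
by rewrite prodEFin -big_mkcond/= mulr_sumr expR_sum; under [in leRHS]eq_bigr do rewrite mulr1.
Qed.

(** Chernoff's bound at the optimal parameter a / l, for the sum and for its
    opposite, where a ^ 2 = B l. *)
Lemma subgaussian_tail (J : pred 'I_n) (l : nat) (B : R) :
  l%:R = (\sum_(i < n | J i) 1)%R :> R -> (0 < l)%N -> (0 < B)%R ->
  P [set w | (B * l%:R <= (\sum_(i < n | J i) eps i w) ^+ 2)%R] <=
  (2 * expR (- (B / 2)))%:E.
Proof.
move=> lE l0 B0.
pose S w := (\sum_(i < n | J i) eps i w)%R.
have mS : measurable_fun setT S.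
  rewrite /S; under eq_fun do rewrite -big_filter.
  exact: measurable_sum.
have l0' : (0 < l%:R :> R)%R by rewrite ltr0n.
have tail (s : R) : (s ^+ 2 = 1)%R -> P [set w | (Num.sqrt (B * l%:R) <= s * S w)%R] <= (expR (- (B / 2)))%:E.
  move=> s1.
  have mX : measurable_fun setT (fun w => s * S w)%R by exact: measurable_funM.
  pose X : {RV P >-> R} := HB.pack (fun w => s * S w)%R (isMeasurableFun.Build _ _ _ _ _ mX).
  pose a := Num.sqrt (B * l%:R).
  have a0 : (0 < a)%R by rewrite sqrtr_gt0 mulr_gt0.
  have a2 : (a ^+ 2 = B * l%:R)%R by rewrite sqr_sqrtr// mulr_ge0// ltW.
  apply: le_trans (chernoff X a (divr_gt0 a0 l0')) _.
  rewrite /mmt_gen_fun unlock.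
  apply: (@le_trans _ _ ((expR ((s * (a / l%:R)) ^+ 2 / 2 * l%:R))%:E * (expR (- (a / l%:R * a)))%:E)).
    apply: lee_wpmul2r; first by rewrite lee_fin expR_ge0.
    rewrite lE; apply: le_trans (subgaussian_mgf_sum _ _).
    rewrite le_eqVlt; apply/orP; left; apply/eqP/eq_integral => w _ /=.
    by congr (expR _)%:E; rewrite -/(S w) -lE; ring.
  rewrite -EFinM -expRD lee_fin ler_expR exprMn s1.
  rewrite le_eqVlt; apply/orP; left; apply/eqP.
  have -> : (B = a ^+ 2 / l%:R)%R by rewrite a2 mulfK ?gt_eqF.
  by field; rewrite gt_eqF.
have mt (s : R) : measurable [set w | (Num.sqrt (B * l%:R) <= s * S w)%R].
  rewrite -[X in measurable X]setTI.
  apply: (@measurable_fun_le _ _ _ setT (cst _) (fun w => s * S w)%R) => //.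
  exact: measurable_funM.
apply: (@le_trans _ _ (P ([set w | (Num.sqrt (B * l%:R) <= 1 * S w)%R] `|`
                          [set w | (Num.sqrt (B * l%:R) <= -1 * S w)%R]))).
  apply: le_measure; rewrite ?inE.
  - rewrite -[X in measurable X]setTI.
    apply: (@measurable_fun_le _ _ _ setT (cst _) (fun w => S w ^+ 2)%R) => //.
    exact: measurable_funX.
  - by apply: measurableU.
  - move=> w /= /ler_wsqrtr; rewrite sqrtr_sqr -/(S w) mul1r mulN1r.
    by rewrite ler_normr => /orP.
apply: (le_trans (measureU2 P (mt 1%R) (mt (-1)%R))).
rewrite mulrDl !mul1r EFinD; apply: leeD; apply: tail.
  by rewrite expr1n.
by rewrite sqrrN expr1n.
Qed.
End SubgaussianTail.

(** * Chaining: from dyadic increments to all increments *)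

Section Chaining.
Context (R : realType).

Lemma ln2_le1 : ln (2 : R) <= 1.
Proof. by rewrite -[leRHS]expRK ler_ln ?posrE ?expR_gt0//; have := expR_ge1Dx (1 : R); lra. Qed.

Variables (W : nat -> R) (n s : nat) (q : R).

(** The squared threshold, without its constant, of the increments over blocks
    of 2 ^ i positions. *)
Definition scale_level (i : nat) : R := 2 * ln (n%:R / (2 ^ i)%N%:R) + q.

Hypotheses (q_ge : 5 * 60 <= q) (s_le : (s <= 14)%N) (s_big : 16 * 16 * 64 <= (2 ^ s)%N%:R :> R).
Hypothesis dyadic_bound : forall i u v : nat,
  (u < v <= u + 2 ^ s.+1)%N -> (v * 2 ^ i <= n)%N ->
  (W (v * 2 ^ i)%N - W (u * 2 ^ i)%N) ^+ 2 <=
    3 / 2 * ((v - u) * 2 ^ i)%N%:R * scale_level i.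

Let floor2 i a := (a %/ 2 ^ i * 2 ^ i)%N.

Lemma scale_level_ge i : (2 ^ i <= n)%N -> 5 * 60 <= scale_level i.
Proof.
move=> in_; apply: (le_trans q_ge); rewrite lerDr mulr_ge0// ln_ge0//.
by rewrite ler_pdivlMr ?ltr0n ?expn_gt0// mul1r ler_nat.
Qed.

Lemma scale_levelS i : (2 ^ i.+1 <= n)%N ->
  scale_level i <= 5 / 4 * scale_level i.+1.
Proof.
move=> in_; have := scale_level_ge in_.
have n0 : (0 < n)%N by apply: leq_trans in_; rewrite expn_gt0.
have -> : scale_level i = scale_level i.+1 + 2 * ln 2.
  rewrite /scale_level addrAC -mulrDr; congr (2 * _ + _).
  rewrite -lnM ?posrE ?divr_gt0 ?ltr0n ?expn_gt0//; congr ln.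
  by rewrite expnS natrM; field; rewrite pnatr_eq0 -lt0n expn_gt0.
by have := ln2_le1; lra.
Qed.

(** Each halving of the precision costs one increment over a block.  The block
    sizes grow geometrically and the levels hardly change, so the last term
    dominates: 25 is large enough for (5 + sqrt (3 / 2)) ^ 2 * 5 / 4 <= 2 * 25
    to close the induction. *)
Lemma chaining_floor i a : (a <= n)%N -> (2 ^ i <= n)%N ->
  (W a - W (floor2 i a)) ^+ 2 <= 25 * (2 ^ i)%N%:R * scale_level i.
Proof.
move=> an; elim: i => [|i IH] in_.
  rewrite /floor2 expn0 divn1 muln1 subrr expr0n/= mulr_ge0//.
  by have := scale_level_ge in_; lra.
have in' : (2 ^ i <= n)%N by apply: leq_trans in_; rewrite leq_exp2l.
have {}IH := IH in'.
have lv := scale_levelS in_.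
have lg := scale_level_ge in_.
have step : (W (floor2 i a) - W (floor2 i.+1 a)) ^+ 2 <=
    3 / 2 * (2 ^ i)%N%:R * scale_level i.
  pose k := (a %/ 2 ^ i)%N.
  have -> : floor2 i.+1 a = (k./2.*2 * 2 ^ i)%N.
    by rewrite /floor2 expnS mulnA muln2 -divn2 -divnMA [(2 ^ i * 2)%N]mulnC.
  rewrite /floor2 -/k -[X in W (X * _)%N](odd_double_half k).
  case ok: (odd k); last first.
    rewrite add0n subrr expr0n/= !mulr_ge0//.
    by have := scale_level_ge in'; lra.
  have := @dyadic_bound i k./2.*2 (1 + k./2.*2); rewrite addnK mul1n add1n ltnSn -addn1 leq_add2l expn_gt0.
  have kE : (1 + k./2.*2 = k)%N by rewrite -[RHS]odd_double_half ok.
  by apply => //; rewrite [X in (X * _)%N]addnC kE (leq_trans (leq_trunc_div a _)).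
have := sqr_ge0 ((W a - W (floor2 i a)) - 4 * (W (floor2 i a) - W (floor2 i.+1 a))).
have p0 : 0 < (2 ^ i)%N%:R :> R by rewrite ltr0n expn_gt0.
rewrite expnS natrM.
set p := (2 ^ i)%N%:R in IH step p0 *.
have := ler_wpM2l (ltW p0) lv.
have : 0 <= p * scale_level i.+1 by rewrite mulr_ge0 ?ltW//; lra.
lra.
Qed.

(** The level i is such that the length l lies between 2 ^ s and 2 ^ (s + 1)
    blocks of size 2 ^ i, or i = 0 for short increments.  Rounding both ends to
    multiples of 2 ^ i leaves an increment that is controlled by hypothesis, and
    two remainders that are tiny because 2 ^ s is large.  The constant 3 / 2 of
    the hypothesis thus degrades to at most 2. *)
Lemma chaining_bound a b : (a < b <= n)%N ->
  (W b - W a) ^+ 2 <= 2 * (b - a)%N%:R * (2 * ln (n%:R / (b - a)%N%:R) + q).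
Proof.
move=> /andP[ab bn].
pose l := (b - a)%N; rewrite -/l.
have l0 : (0 < l)%N by rewrite subn_gt0.
have ln_ : (l <= n)%N by rewrite (leq_trans _ bn)// leq_subr.
have n0 := leq_trans l0 ln_.
have [i [lup llow dlt]] : exists i, [/\ (l < 2 ^ i * 2 ^ s.+1)%N, (2 ^ i <= l)%N &
   (0 < i)%N -> (2 ^ i * 2 ^ s <= l)%N].
  exists (trunc_log 2 l - s)%N.
  have h1 := @trunc_log_ltn 2 l isT; have h2 := @trunc_logP 2 l isT l0.
  split.
  - by apply: (leq_trans h1); rewrite -expnD leq_exp2l// addnS ltnS addnC -leq_subLR.
  - by apply: (leq_trans _ h2); rewrite leq_exp2l// leq_subr.
  - by rewrite subn_gt0 => /ltnW h; rewrite -expnD subnK.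
have in_ : (2 ^ i <= n)%N by exact: leq_trans ln_.
have lg := scale_level_ge in_.
have p0 : 0 < (2 ^ i)%N%:R :> R by rewrite ltr0n expn_gt0.
have l0' : 0 < l%:R :> R by rewrite ltr0n.
have n0' : 0 < n%:R :> R by rewrite ltr0n.
have lvl : scale_level i <= 11 / 10 * (2 * ln (n%:R / l%:R) + q).
  have lnl : 0 <= ln (n%:R / l%:R : R).
    by apply: ln_ge0; rewrite ler_pdivlMr// mul1r ler_nat.
  suff : ln (n%:R / (2 ^ i)%N%:R : R) <= ln (n%:R / l%:R) + 15.
    rewrite /scale_level; move: lnl q_ge; move: (ln _) (ln _) => x y.
    lra.
  have p1 : 0 < (2 ^ s.+1)%N%:R :> R by rewrite ltr0n expn_gt0.
  apply: (@le_trans _ _ (ln (n%:R / l%:R) + ln (2 ^ s.+1)%N%:R)); last first.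
    rewrite lerD2l natrX lnXn// -[ln _ *+ _]mulr_natl.
    apply: (@le_trans _ _ s.+1%:R); last by rewrite ler_nat.
    by rewrite ler_piMr//; exact: ln2_le1.
  rewrite -lnM ?posrE ?divr_gt0// ler_ln ?posrE ?divr_gt0 ?mulr_gt0 ?invr_gt0//.
  rewrite ler_pdivrMr// -!mulrA; apply: ler_peMr; first exact: ltW.
  rewrite mulrC ler_pdivlMr// mul1r mulrC -natrM ler_nat.
  exact: ltnW.
pose u := (a %/ 2 ^ i)%N; pose v := (b %/ 2 ^ i)%N.
(* At level 0 the rounding is exact. *)
pose e : R := if i is 0 then 0 else (2 ^ i)%N%:R.
have fl c : (c <= n)%N ->
    (W c - W (c %/ 2 ^ i * 2 ^ i)%N) ^+ 2 <= 25 * e * scale_level i.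
  rewrite /e; case: (i) in_ => [|j] in_ cn; last exact: chaining_floor.
  by rewrite expn0 divn1 muln1 subrr expr0n/= mulr0 mul0r.
have {fl} [fa fb] := (fl a (ltnW (leq_trans ab bn)), fl b bn).
have uv : (u <= v)%N by apply: leq_div2r; exact: ltnW.
have va : (v * 2 ^ i <= b)%N := leq_trunc_div _ _.
have ua : (u * 2 ^ i <= a)%N := leq_trunc_div _ _.
have ua' : (a < u.+1 * 2 ^ i)%N by rewrite ltn_ceil ?expn_gt0.
have mid : (W (v * 2 ^ i)%N - W (u * 2 ^ i)%N) ^+ 2 <=
     3 / 2 * ((v - u) * 2 ^ i)%N%:R * scale_level i.
  have [uv'|vu] := ltnP u v; last first.
    have -> : v = u by apply/eqP; rewrite eqn_leq uv vu.
    by rewrite subrr expr0n/= !mulr_ge0//; lra.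
  apply: dyadic_bound; last exact: leq_trans bn.
  rewrite uv'/= -ltnS -(@ltn_pmul2r (2 ^ i)) ?expn_gt0//.
  apply: (leq_ltn_trans va).
  move: (2 ^ i)%N (2 ^ s.+1)%N ua' lup => p r ua' lup.
  have -> : ((u + r).+1 * p = u.+1 * p + p * r)%N.
    by rewrite -addSn mulnDl (mulnC r).
  by rewrite -(subnKC (ltnW ab)) -addSn leq_add// ltnW.
have e0 : 0 <= e by rewrite /e; case: (i).
have small : e <= l%:R / (16 * 16 * 64) :> R.
  suff : e * (2 ^ s)%N%:R <= l%:R by have := ler_wpM2l e0 s_big; lra.
  rewrite /e; case: (i) dlt => [_|j /(_ isT) h]; first by rewrite mul0r.
  by rewrite -natrM ler_nat.
have len : ((v - u) * 2 ^ i)%N%:R <= l%:R + e :> R.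
  have : ((v - u) * 2 ^ i <= l + (if i is 0 then 0 else 2 ^ i))%N.
    move: va ua'; rewrite /u /v; case: (i) => [|j] va ua'.
      by rewrite expn0 !divn1 muln1 addn0.
    rewrite mulnBl leq_subLR; apply: (leq_trans va).
    rewrite -[leqLHS](subnKC (ltnW ab)) [leqRHS]addnCA [leqLHS]addnC leq_add2l.
    by rewrite -mulSnr ltnW.
  by rewrite -(ler_nat R) natrD /e; case: (i).
have X0 : 0 <= scale_level i by apply: le_trans lg.
have {mid} mid : (W (v * 2 ^ i)%N - W (u * 2 ^ i)%N) ^+ 2 <= 3 / 2 * (l%:R + e) * scale_level i.
  apply: (le_trans mid); apply: ler_wpM2r => //.
  by apply: ler_wpM2l => //; rewrite divr_ge0.
have {e0 small} eX : e * scale_level i <= l%:R / (16 * 16 * 64) * scale_level i.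
  by apply: ler_wpM2r.
have lX : l%:R * scale_level i <= l%:R * (11 / 10 * (2 * ln (n%:R / l%:R) + q)).
  by rewrite ler_pM2l.
have lX0 : 0 <= l%:R * scale_level i by apply: mulr_ge0.
have := sqr_ge0 ((W b - W (v * 2 ^ i)%N) + (W a - W (u * 2 ^ i)%N)).
have := sqr_ge0 ((W b - W (v * 2 ^ i)%N) - (W a - W (u * 2 ^ i)%N) - 1 / 10 * (W (v * 2 ^ i)%N - W (u * 2 ^ i)%N)).
lra.
Qed.

End Chaining.

(** * Probability of the noise event *)

Section NoiseEvent.
Context (R : realType).

(** The contrast weighs the two increments, each divided by the square root of its
    length, by the square roots of x / (x + y) and y / (x + y), where x and y are
    the lengths.  The factor 2
    lost in (a + b) ^ 2 <= 2 (a ^ 2 + b ^ 2) and the factor 2 of the hypothesis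
    make up the square of the 2 in the event. *)
Lemma noise_stat_le n (v : 'rV[R]_n) (q : R) : 0 <= q ->
  (forall a b, (1 <= a < b)%N -> (b <= n.+1)%N ->
    (psum v b - psum v a) ^+ 2 <= 2 * (b - a)%N%:R * (2 * ln (n%:R / (b - a)%N%:R) + q)) ->
  forall t1 t2 t3, in_T3 n t1 t2 t3 ->
    `|noise_stat v t1 t2 t3| <= 2 * log_threshold n q t1 t2 t3.
Proof.
move=> q0 H t1 t2 t3 /and4P[t10 t12 t23 t3n].
have t123 : (t1 < t2 < t3)%N by rewrite t12.
have [_ [_ T1 T2]] := @log_threshold_sqr R n q t1 t2 t3 q0 t123 ltac:(lia).
have TT : 0 <= log_threshold n q t1 t2 t3 by exact: sqrtr_ge0.
rewrite -(@ler_pXn2r _ 2)// ?nnegrE ?mulr_ge0// real_normK ?num_real//.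
rewrite noise_stat_sqr//.
have H1 := H t1 t2 ltac:(lia) ltac:(lia).
have H2 := H t2 t3 ltac:(lia) ltac:(lia).
have -> : bridge v t1 t2 t3 = (psum v t2 - psum v t1) -
  (t2 - t1)%N%:R / (t3 - t1)%N%:R * ((psum v t3 - psum v t2) + (psum v t2 - psum v t1)).
  by rewrite /bridge; ring.
move: H1 H2; set A := psum v t2 - psum v t1; set B := psum v t3 - _.
have : 0 < (t2 - t1)%N%:R :> R by rewrite ltr0n subn_gt0.
have : 0 < (t3 - t2)%N%:R :> R by rewrite ltr0n subn_gt0.
have -> : (t3 - t1 = (t2 - t1) + (t3 - t2))%N by lia.
rewrite natrD exprMn.
move: (log_threshold n q t1 t2 t3 ^+ 2) T1 T2 => T.
move: (ln _) (ln _) => L2 L1.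
move: ((t2 - t1)%N%:R : R) ((t3 - t2)%N%:R : R) => x y T1 T2 y0 x0 HA HB.
have -> : (A - x / (x + y) * (B + A)) ^+ 2 * (x + y) / (x * y) =
   (A * y - B * x) ^+ 2 / (x * y * (x + y)).
  by field; rewrite !gt_eqF// addr_gt0.
rewrite ler_pdivrMr ?mulr_gt0 ?addr_gt0//.
have HA' : A ^+ 2 <= 2 * x * T.
  by apply: (le_trans HA); rewrite ler_pM2l// mulr_gt0.
have HB' : B ^+ 2 <= 2 * y * T.
  by apply: (le_trans HB); rewrite ler_pM2l// mulr_gt0.
have := ler_wpM2l (sqr_ge0 y) HA'.
have := ler_wpM2l (sqr_ge0 x) HB'.
have := sqr_ge0 (A * y + B * x).
lra.
Qed.

Lemma sum_sqrt_pow2 k : \sum_(i < k.+1) Num.sqrt ((2 ^ i)%N%:R : R) <= 4 * Num.sqrt (2 ^ k)%N%:R.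
Proof.
elim: k => [|k IH].
  by rewrite big_ord1 expn0 sqrtr1; lra.
rewrite big_ord_recr/= expnS natrM sqrtrM//.
apply: (le_trans (lerD IH (lexx _))).
have : 0 <= Num.sqrt (2 ^ k)%N%:R :> R by exact: sqrtr_ge0.
have : 4 / 3 <= Num.sqrt 2%:R :> R.
  by rewrite -(@ler_pXn2r _ 2)// ?nnegrE ?sqrtr_ge0 ?divr_ge0// sqr_sqrtr//; lra.
by nra.
Qed.

Context d (T : measurableType d) (P : probability T R) (n : nat).
Variables (eps : 'I_n -> {RV P >-> R}).

Lemma measurable_noise_psum t :
  measurable_fun setT (fun w => psum (noise_vec eps w) t).
Proof.
rewrite /psum /noise_vec; under eq_fun do under eq_bigr do rewrite mxE.
under eq_fun do rewrite -big_filter.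
exact: measurable_sum.
Qed.

Lemma measurable_eventA (q : R) : measurable (eventA eps q).
Proof.
have -> : eventA eps q = \bigcap_t1 \bigcap_t2 \bigcap_t3
    (if in_T3 n t1 t2 t3 then
     [set w | `|noise_stat (noise_vec eps w) t1 t2 t3| <= 2 * log_threshold n q t1 t2 t3]
     else setT).
  apply/seteqP; split => w /=.
    by move=> H t1 _ t2 _ t3 _; case: ifP => // /H.
  by move=> H t1 t2 t3 t123; have := H t1 I t2 I t3 I; rewrite t123.
apply: bigcapT_measurable => t1; apply: bigcapT_measurable => t2.
apply: bigcapT_measurable => t3; case: ifP => // /and4P[_ /ltnW t12 /ltnW t23 _].
rewrite -[X in measurable X]setTI.
apply: (@measurable_fun_le _ _ _ setT (fun w => `|noise_stat (noise_vec eps w) t1 t2 t3|) (cst _)) => //.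
apply: measurableT_comp => //.
rewrite /noise_stat; apply: measurable_funM => //; apply: measurable_funB.
  under eq_fun do rewrite seg_meanE//.
  by apply: measurable_funM => //; apply: measurable_funB; exact: measurable_noise_psum.
under eq_fun do rewrite seg_meanE//.
by apply: measurable_funM => //; apply: measurable_funB; exact: measurable_noise_psum.
Qed.

Lemma probability_bigsetU k (F : nat -> set T) (p : nat -> R) :
  (forall i, (i < k)%N -> measurable (F i) /\ (P (F i) <= (p i)%:E)%E) ->
  measurable (\big[setU/set0]_(i < k) F i) /\
  (P (\big[setU/set0]_(i < k) F i) <= (\sum_(i < k) p i)%:E)%E.
Proof.
elim: k => [|k IH] H; first by rewrite !big_ord0 measure0.
have [mF PF] := H k (ltnSn k).
have [|mU PU] := IH; first by move=> i ik; apply: H; apply: ltnW.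
rewrite !big_ord_recr/=; split; first exact: measurableU.
apply: (le_trans (measureU2 P mU mF)); rewrite EFinD; exact: leeD.
Qed.

Lemma mem_bigsetU k (F : nat -> set T) i w :
  (i < k)%N -> F i w -> (\big[setU/set0]_(j < k) F j) w.
Proof. by move=> ik Fw; rewrite -bigcup_mkord; exists i. Qed.

(** The number of positions at level i times the tail probability of one
    increment: the power 3 / 2 of 2 ^ i / n in the tail beats the number
    n / 2 ^ i of positions and leaves a square root, summable over i. *)
Lemma expR_level (q : R) i : (0 < n)%N ->
  (n %/ 2 ^ i)%N%:R * expR (- (3 / 4 * scale_level n q i)) <=
  expR (- (3 / 4 * q)) / Num.sqrt n%:R * Num.sqrt (2 ^ i)%N%:R.
Proof.
move=> n0.
have n0' : 0 < n%:R :> R by rewrite ltr0n.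
have p0 : 0 < (2 ^ i)%N%:R :> R by rewrite ltr0n expn_gt0.
pose r : R := n%:R / (2 ^ i)%N%:R.
have r0 : 0 < r by rewrite divr_gt0.
have le_r : (n %/ 2 ^ i)%N%:R <= r.
  by rewrite ler_pdivlMr// -natrM ler_nat leq_trunc_div.
apply: (le_trans (ler_wpM2r (expR_ge0 _) le_r)).
rewrite -[X in X * _ <= _](lnK (x := r)) ?posrE// -expRD.
have -> : ln r - 3 / 4 * scale_level n q i = - (3 / 4 * q) - ln r / 2.
  by rewrite /scale_level -/r; lra.
rewrite expRD -[leRHS]mulrA ler_pM2l ?expR_gt0//.
rewrite -[leLHS]ger0_norm ?expR_ge0// -sqrtr_sqr -expRM_natl.
have -> : 2%:R * - (ln r / 2) = - ln r by field.
by rewrite expRN lnK ?posrE// /r invf_div sqrtrM ?ler0n// sqrtrV ?ler0n// mulrC.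
Qed.

Variables (s : nat) (q : R).
Hypotheses (sg : subgaussian_noise eps) (q_ge : 5 * 60 <= q) (s_le : (s <= 14)%N)
  (s_big : 16 * 16 * 64 <= (2 ^ s)%N%:R :> R) (n_gt0 : (0 < n)%N).

Definition large_increment i u k : set T :=
  if (2 ^ i <= n)%N && ((u + k.+1) * 2 ^ i <= n)%N then
  [set w | 3 / 2 * scale_level n q i * (k.+1 * 2 ^ i)%N%:R <=
     (psum (noise_vec eps w) ((u + k.+1) * 2 ^ i).+1 -
      psum (noise_vec eps w) (u * 2 ^ i).+1) ^+ 2]
  else set0.

Lemma large_increment_prob i u k :
  measurable (large_increment i u k) /\
  (P (large_increment i u k) <= (2 * expR (- (3 / 4 * scale_level n q i)))%:E)%E.
Proof.
rewrite /large_increment; case: ifP => [/andP[in_ ukn]|_]; last first.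
  by rewrite measure0 lee_fin mulr_ge0// expR_ge0.
have lg : 5 * 60 <= scale_level n q i := scale_level_ge q_ge in_.
split.
  rewrite -[X in measurable X]setTI.
  apply: (@measurable_fun_le _ _ _ setT (cst _) (fun w => (psum (noise_vec eps w) ((u + k.+1) * 2 ^ i).+1 -
      psum (noise_vec eps w) (u * 2 ^ i).+1) ^+ 2)) => //.
  by apply: measurable_funX; apply: measurable_funB; exact: measurable_noise_psum.
have le_uk : ((u * 2 ^ i).+1 <= ((u + k.+1) * 2 ^ i).+1)%N.
  by rewrite ltnS leq_mul2r leq_addr orbT.
pose J := fun j : 'I_n => ((u * 2 ^ i).+1 <= j.+1 < ((u + k.+1) * 2 ^ i).+1)%N.
have lE : (k.+1 * 2 ^ i)%N%:R = \sum_(j < n | J j) 1 :> R.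
  by rewrite /J sum1_seg// subSS -mulnBl addKn.
have := @subgaussian_tail _ _ _ _ _ _ sg J (k.+1 * 2 ^ i)%N (3 / 2 * scale_level n q i) lE.
rewrite muln_gt0 expn_gt0/= => /(_ isT).
have -> : 3 / 2 * scale_level n q i / 2 = 3 / 4 * scale_level n q i by field.
move=> H; apply: (le_trans _ (H _)); last by rewrite mulr_gt0//; lra.
rewrite le_eqVlt; apply/orP; left; apply/eqP; congr (P _).
apply/funext => w /=; rewrite -psum_seg// /J.
congr (is_true (_ <= _ ^+ 2)); by apply: eq_bigr => j _; rewrite mxE.
Qed.

Definition bad_event : set T :=
  \big[setU/set0]_(i < (trunc_log 2 n).+1) \big[setU/set0]_(u < n %/ 2 ^ i)
     \big[setU/set0]_(k < 2 ^ s.+1) large_increment i u k.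

Lemma bad_event_prob : measurable bad_event /\
  (P bad_event <= (8 * (2 ^ s.+1)%N%:R * expR (- (3 / 4 * q)))%:E)%E.
Proof.
have n0' : 0 < n%:R :> R by rewrite ltr0n.
pose A := expR (- (3 / 4 * q)) / Num.sqrt n%:R : R.
have A0 : 0 <= A by rewrite divr_ge0 ?expR_ge0.
have := @probability_bigsetU (trunc_log 2 n).+1 (fun i => \big[setU/set0]_(u < n %/ 2 ^ i)
     \big[setU/set0]_(k < 2 ^ s.+1) large_increment i u k)
   (fun i => 2 * (2 ^ s.+1)%N%:R * (A * Num.sqrt (2 ^ i)%N%:R)).
case.
  move=> i _.
  have := @probability_bigsetU (n %/ 2 ^ i) (fun u =>
     \big[setU/set0]_(k < 2 ^ s.+1) large_increment i u k)
   (fun u => (2 ^ s.+1)%N%:R * (2 * expR (- (3 / 4 * scale_level n q i)))).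
  case.
    move=> u _.
    have := @probability_bigsetU (2 ^ s.+1) (fun k => large_increment i u k)
       (fun k => 2 * expR (- (3 / 4 * scale_level n q i))).
    case; first by move=> k _; exact: large_increment_prob.
    by rewrite sumr_const card_ord -[_ *+ (2 ^ _)]mulr_natl.
  move=> mU PU; split=> //; apply: (le_trans PU).
  rewrite sumr_const card_ord -[_ *+ (n %/ _)]mulr_natl lee_fin.
  have := expR_level q i n_gt0; rewrite -/A => /(ler_wpM2l (ler0n R (2 ^ s.+1))).
  lra.
move=> mU PU; split=> //; apply: (le_trans PU).
rewrite lee_fin -!mulr_sumr.
have := ler_wpM2l A0 (sum_sqrt_pow2 (trunc_log 2 n)).
have : A * Num.sqrt (2 ^ trunc_log 2 n)%N%:R <= expR (- (3 / 4 * q)).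
  rewrite /A mulrAC ler_pdivrMr ?sqrtr_gt0//.
  rewrite ler_pM2l ?expR_gt0//; apply: ler_wsqrtr.
  by rewrite ler_nat; exact: trunc_logP.
set B := A * Num.sqrt _; set C := A * _ => h1; rewrite mulrCA -/B => h2.
have h3 : C <= 4 * expR (- (3 / 4 * q)) by lra.
by have := ler_wpM2l (ler0n R (2 ^ s.+1)) h3; lra.
Qed.

Lemma good_sub_eventA : ~` bad_event `<=` eventA eps q.
Proof.
move=> w nb; apply: noise_stat_le; first by apply: le_trans q_ge.
move=> a b /andP[a1 ab] bn.
pose W t := psum (noise_vec eps w) t.+1.
have := @chaining_bound R W n s q q_ge s_le s_big _ a.-1 b.-1.
rewrite /W !prednK//; last exact: leq_ltn_trans ab.
have -> : (b.-1 - a.-1 = b - a)%N by lia.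
apply; last by lia.
move=> i u v /andP[uv vu] vn.
have pi : (0 < 2 ^ i)%N by rewrite expn_gt0.
have in_ : (2 ^ i <= n)%N.
  by apply: (leq_trans _ vn); rewrite leq_pmull//; case: (v) uv.
rewrite leNgt; apply/negP => bad; apply: nb.
rewrite /bad_event.
have [k kE] : exists k, v = (u + k.+1)%N by exists (v - u).-1; lia.
have ks : (k < 2 ^ s.+1)%N by move: vu; rewrite kE leq_add2l.
have i_lt : (i < (trunc_log 2 n).+1)%N by rewrite ltnS; exact: trunc_log_max.
have u_lt : (u < n %/ 2 ^ i)%N by rewrite leq_divRL//; apply: (leq_trans _ vn); rewrite leq_mul2r uv orbT.
apply: (@mem_bigsetU _ (fun i => \big[setU/set0]_(u < n %/ 2 ^ i)
  \big[setU/set0]_(k < 2 ^ s.+1) large_increment i u k) i) => //.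
apply: (@mem_bigsetU _ (fun u =>
  \big[setU/set0]_(k < 2 ^ s.+1) large_increment i u k) u) => //.
apply: (@mem_bigsetU _ (large_increment i u) k) => //.
rewrite /large_increment in_ -kE vn/=.
apply: ltW; move: bad; rewrite kE addKn.
by rewrite mulrAC.
Qed.

Lemma eventA_prob :
  ((1 - (8 * (2 ^ s.+1)%N%:R + 1) * expR (- (3 / 4 * q)))%:E < P (eventA eps q))%E.
Proof.
have [mB PB] := bad_event_prob.
apply: (@lt_le_trans _ _ (P (~` bad_event))); last first.
  apply: le_measure; rewrite ?inE; [exact: measurableC|exact: measurable_eventA|].
  exact: good_sub_eventA.
rewrite probability_setC//.
apply: (@lt_le_trans _ _ (1 - (8 * (2 ^ s.+1)%N%:R * expR (- (3 / 4 * q)))%:E)%E).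
  by rewrite -EFinB lte_fin; have := expR_gt0 (- (3 / 4 * q)); lra.
exact: leeB.
Qed.

End NoiseEvent.

(** * The criterion as the cost of a path *)

Lemma cpt_rcons n tau l : cpt n tau l = nth n.+1 (1%N :: rcons tau n.+1) l.
Proof.
case: l => [//|l]; rewrite /cpt/= nth_rcons; case: ltngtP => // h.
- by rewrite nth_default// ltnW.
- by rewrite nth_default// h.
Qed.

(** With the boundary n + 1 appended, being a change-point vector becomes a path
    condition, which splits along concatenations. *)
Lemma is_cpvecE n tau : (0 < n)%N -> is_cpvec n tau = path ltn 1 (rcons tau n.+1).
Proof.
move=> n0; rewrite (path_sortedE ltn_trans) !(sorted_pairwise ltn_trans).
rewrite pairwise_rcons all_rcons ltnS n0/= /is_cpvec (sorted_pairwise ltn_trans).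
rewrite andbC andbA -all_predI; congr (_ && _).
Qed.

Section Criterion.
Context (R : realType) (n : nat).
Hypothesis n_gt0 : (0 < n)%N.
Implicit Types (v y : 'rV[R]_n) (tau : seq nat).

(** The residual sum of squares of v on [a, b). *)
Definition rss v (a b : nat) : R :=
  \sum_(i < n | (a <= i.+1 < b)%N) v 0 i ^+ 2 -
  (psum v b - psum v a) ^+ 2 / (b - a)%N%:R.

Definition seg_cost (L q : R) v (a b : nat) : R :=
  rss v a b + L * (q + 2 * ln (n%:R / (b - a)%N%:R)).

Fixpoint path_cost (c : nat -> nat -> R) (x : nat) (s : seq nat) : R :=
  if s is z :: s' then c x z + path_cost c z s' else 0.

Lemma path_cost_cat c x s1 s2 :
  path_cost c x (s1 ++ s2) = path_cost c x s1 + path_cost c (last x s1) s2.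
Proof. by elim: s1 x => [|z s1 IH] x /=; rewrite ?add0r// IH addrA. Qed.

Lemma path_cost_nth c x0 x s :
  path_cost c x s = \sum_(i < size s) c (nth x0 (x :: s) i) (nth x0 (x :: s) i.+1).
Proof.
elim: s x => [|z s IH] x /=; first by rewrite big_ord0.
by rewrite big_ord_recl IH.
Qed.

Section Segments.
Variable tau : seq nat.
Hypothesis tauP : is_cpvec n tau.

Lemma cpt0 : cpt n tau 0 = 1%N. Proof. by []. Qed.

Lemma cpt_last : cpt n tau (size tau).+1 = n.+1.
Proof. by rewrite /cpt/= nth_default. Qed.

Lemma cpt_lt i j : (i < j)%N -> (j <= (size tau).+1)%N -> (cpt n tau i < cpt n tau j)%N.
Proof.
move: tauP; rewrite is_cpvecE// => p ij js; rewrite !cpt_rcons.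
by apply: (sorted_ltn_nth ltn_trans) => //; rewrite inE/= size_rcons; lia.
Qed.

Lemma cpt_le i j : (i <= j)%N -> (j <= (size tau).+1)%N -> (cpt n tau i <= cpt n tau j)%N.
Proof. by rewrite leq_eqVlt => /predU1P[->//|ij] js; rewrite ltnW// cpt_lt. Qed.

Lemma cpt_ge1 i : (1 <= cpt n tau i)%N.
Proof.
have [h|h] := leqP i (size tau).+1; first by rewrite -[1%N]cpt0 cpt_le.
by rewrite /cpt nth_default//= ltnW.
Qed.

Lemma cpt_max i : (cpt n tau i <= n.+1)%N.
Proof.
have [h|h] := leqP i (size tau).+1; first by rewrite -cpt_last cpt_le.
by rewrite /cpt nth_default//= ltnW.
Qed.

Lemma in_seg_inj l l' (i : 'I_n) : (l <= size tau)%N -> (l' <= size tau)%N ->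
  in_seg tau l i -> in_seg tau l' i -> l = l'.
Proof.
wlog ll : l l' / (l <= l')%N.
  by move=> H; case/orP: (leq_total l l') => h *; [|symmetry]; exact: H.
move: ll; rewrite leq_eqVlt => /predU1P[//|ll] ls l's /andP[_ h1] /andP[h2 _].
have := @cpt_le l.+1 l' ll (leq_trans l's (leqnSn _)).
by move: h1 h2; lia.
Qed.

(** The segments partition the positions because the partial sums telescope. *)
Lemma sum_segs (f : 'I_n -> R) :
  \sum_i f i = \sum_(l < (size tau).+1) \sum_(i < n | in_seg tau l i) f i.
Proof.
pose v := \row_i f i.
have E l : (l < (size tau).+1)%N -> \sum_(i < n | in_seg tau l i) f i =
    psum v (cpt n tau l.+1) - psum v (cpt n tau l).
  move=> ls; rewrite -psum_seg; last by apply: cpt_le.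
  by apply: eq_bigr => i _; rewrite mxE.
under [RHS]eq_bigr => l _ do rewrite E//.
rewrite -(big_mkord xpredT (fun l => psum v (cpt n tau l.+1) - psum v (cpt n tau l))).
rewrite telescope_sumr// cpt0 cpt_last psum1 subr0.
by apply: eq_big => i; rewrite ?mxE//= ltnS ltn_ord.
Qed.

Definition seg_means y : 'rV[R]_n :=
  \row_i \sum_(l < (size tau).+1 | in_seg tau l i) seg_mean y (cpt n tau l) (cpt n tau l.+1).

Lemma seg_meansE y l i : (l <= size tau)%N -> in_seg tau l i ->
  seg_means y 0 i = seg_mean y (cpt n tau l) (cpt n tau l.+1).
Proof.
move=> ls il; rewrite mxE (bigD1 (Ordinal (ls : (l < (size tau).+1)%N)))//=.
rewrite big1 ?addr0// => l' /andP[il' /eqP nl].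
by case: nl; apply/val_inj/(in_seg_inj _ _ il' il) => //; rewrite -ltnS.
Qed.

Lemma sqnorm_seg_means y :
  sqnorm (y - seg_means y) =
  \sum_(l < (size tau).+1) rss y (cpt n tau l) (cpt n tau l.+1).
Proof.
rewrite /sqnorm /dotv sum_segs; apply: eq_bigr => l _.
have ll : (cpt n tau l < cpt n tau l.+1)%N by apply: cpt_lt.
set a := cpt n tau l in ll *; set b := cpt n tau l.+1 in ll *.
pose m := seg_mean y a b.
transitivity (\sum_(i < n | (a <= i.+1 < b)%N) (y 0 i ^+ 2 - 2 * m * y 0 i + m ^+ 2 * 1)).
  apply: eq_bigr => i il; rewrite !mxE -/(seg_means y).
  have := @seg_meansE y l i _ il; rewrite mxE => ->; last by rewrite -ltnS.
  by rewrite -/a -/b -/m; ring.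
rewrite big_split sumrB/= -!mulr_sumr sum1_seg; last 2 first.
- by rewrite cpt_ge1 ltnW.
- exact: cpt_max.
rewrite psum_seg; last exact: ltnW.
rewrite /rss /m seg_meanE; last exact: ltnW.
have : 0 < (b - a)%N%:R :> R by rewrite ltr0n subn_gt0.
by move=> h; field; rewrite gt_eqF.
Qed.

Lemma seg_means_proj y : is_orth_proj (piecewise_constant tau) y (seg_means y).
Proof.
split=> [l ls i j il jl|v vP]; first by rewrite (seg_meansE _ ls il) (seg_meansE _ ls jl).
rewrite /dotv sum_segs big1// => l _.
have ll : (cpt n tau l < cpt n tau l.+1)%N by apply: cpt_lt.
have ls : (l <= size tau)%N by rewrite -ltnS.
set m := seg_mean y (cpt n tau l) (cpt n tau l.+1).
case: (pickP (fun i : 'I_n => in_seg tau l i)) => [i0 i0l|none]; last by rewrite big_pred0.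
transitivity (\sum_(i < n | in_seg tau l i) ((y 0 i - m * 1) * v 0 i0)).
  apply: eq_bigr => i il; rewrite !mxE (vP l ls i i0)//.
  have := @seg_meansE y l i ls il; rewrite mxE => ->.
  by rewrite mulr1.
rewrite -mulr_suml sumrB -mulr_sumr sum1_seg; last 2 first.
- by rewrite cpt_ge1 ltnW.
- exact: cpt_max.
rewrite /m /seg_mean divfK ?subrr ?mul0r// gt_eqF// ltr0n subn_gt0//.
Qed.

Lemma dotvC u v : dotv u v = dotv v u :> R.
Proof. by apply: eq_bigr => i _; rewrite mulrC. Qed.

Lemma dotvBr (u v w : 'rV[R]_n) : dotv u (v - w) = dotv u v - dotv u w.
Proof. by rewrite /dotv -sumrB; apply: eq_bigr => i _; rewrite !mxE mulrBr. Qed.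

(** Two orthogonal projections of y on the same subspace give the same residual
    norm, so the choice made by [orth_proj] does not matter. *)
Lemma sqnorm_orth_proj y :
  sqnorm (y - orth_proj tau y) = sqnorm (y - seg_means y).
Proof.
have [pV pO] := seg_means_proj y.
have [oV oO] : is_orth_proj (piecewise_constant tau) y (orth_proj tau y).
  by rewrite /orth_proj; apply: xgetPex; exists (seg_means y).
have sub u v : piecewise_constant tau u -> piecewise_constant tau v ->
    piecewise_constant tau (u - v).
  by move=> uV vV l ls i j il jl; rewrite !mxE (uV l ls i j)// (vV l ls i j).
have := pO _ (sub _ _ oV pV); have := oO _ (sub _ _ oV pV).
rewrite /sqnorm; move: (orth_proj tau y) (seg_means y) => o p h1 h2.
have e1 : dotv (y - o) (y - p) = dotv (y - o) (y - o).
  apply/eqP; rewrite -subr_eq0 -dotvBr; apply/eqP; rewrite -[RHS]h1; congr dotv.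
  by rewrite opprB addrC addrA subrK addrC.
have e2 : dotv (y - p) (y - p) = dotv (y - p) (y - o).
  apply/eqP; rewrite -subr_eq0 -dotvBr; apply/eqP; rewrite -[RHS]h2; congr dotv.
  by rewrite opprB addrC addrA subrK addrC.
by rewrite e2 dotvC e1.
Qed.

Lemma Cr0E L q y :
  Cr0 L q y tau = path_cost (seg_cost L q y) 1 (rcons tau n.+1) - L * q.
Proof.
rewrite (path_cost_nth _ n.+1) size_rcons /Cr0 sqnorm_orth_proj sqnorm_seg_means.
rewrite big_add1 big_mkord.
under [in RHS]eq_bigr do rewrite -!cpt_rcons /seg_cost.
rewrite [X in _ = X - _]big_split/= -[X in _ = _ + X - _]mulr_sumr.
rewrite [X in _ = _ + L * X - _]big_split/= sumr_const card_ord.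
rewrite -[X in _ = _ + L * (_ + X) - _]mulr_sumr -[q *+ _]mulr_natr -addn1 natrD.
by ring.
Qed.

End Segments.

(** The costs outside of the stretch between the two entries last 1 s1 and r
    cancel out. *)
Lemma local_minimality L q y tau s1 m m' r s2 :
  is_pls_estimate L q y tau ->
  rcons tau n.+1 = s1 ++ m ++ r :: s2 ->
  path ltn (last 1%N s1) (rcons m' r) ->
  path_cost (seg_cost L q y) (last 1%N s1) (rcons m r) <=
  path_cost (seg_cost L q y) (last 1%N s1) (rcons m' r).
Proof.
move=> [tauP tmin] tauE pm'.
have [z zE] : exists z, rcons z n.+1 = r :: s2.
  have : last 1%N (rcons tau n.+1) = n.+1 by rewrite last_rcons.
  rewrite tauE !last_cat/= => h; exists (belast r s2).
  by rewrite -h -lastI.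
have tau'E : rcons (s1 ++ m' ++ z) n.+1 = s1 ++ m' ++ r :: s2.
  by rewrite !rcons_cat zE.
have pt := tauP; rewrite is_cpvecE// tauE -cat_rcons !cat_path in pt.
have tau'P : is_cpvec n (s1 ++ m' ++ z).
  rewrite is_cpvecE// tau'E -cat_rcons !cat_path pm' last_rcons.
  by case/andP: pt => -> /andP[_]; rewrite last_rcons.
have := tmin _ tau'P; rewrite !Cr0E// tau'E tauE -![m ++ _]cat_rcons -[m' ++ _]cat_rcons.
by rewrite lerD2r !path_cost_cat lerD2l !last_rcons lerD2r.
Qed.

End Criterion.

(** * Comparisons of the estimate with its neighbours *)

Section Contrasts.
Context (R : realType) (n : nat).
Implicit Types v : 'rV[R]_n.

(** Pythagoras: the contrast is the component of v along the unit vector that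
    is constant on [a, t) and on [t, b), and orthogonal to the constants. *)
Lemma rss_split v a t b : (a < t < b)%N ->
  rss v a b = rss v a t + rss v t b + noise_stat v a t b ^+ 2.
Proof.
move=> atb; rewrite noise_stat_sqr//; have /andP[at_ tb] := atb.
pose v2 : 'rV[R]_n := \row_i v 0 i ^+ 2.
have sqE c e : (c <= e)%N ->
    \sum_(i < n | (c <= i.+1 < e)%N) v 0 i ^+ 2 = psum v2 e - psum v2 c.
  by move=> ce; rewrite -psum_seg//; apply: eq_bigr => i _; rewrite mxE.
rewrite /rss !sqE; [|lia..].
rewrite /bridge.
have -> : (b - a = (t - a) + (b - t))%N by lia.
rewrite natrD.
have : 0 < (t - a)%N%:R :> R by rewrite ltr0n subn_gt0.
have : 0 < (b - t)%N%:R :> R by rewrite ltr0n subn_gt0.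
move: ((t - a)%N%:R : R) ((b - t)%N%:R : R) => x y y0 x0.
by field; rewrite !gt_eqF// addr_gt0.
Qed.

Lemma rss_nil v a : rss v a a = 0.
Proof. by rewrite /rss subrr expr0n mul0r subr0 big_pred0// => i; lia. Qed.

Lemma seg_cost_split L q v a t b : 0 <= q -> (a < t < b)%N -> (b - a <= n)%N ->
  seg_cost L q v a t + seg_cost L q v t b =
  seg_cost L q v a b + L * log_threshold n q a t b ^+ 2 - noise_stat v a t b ^+ 2.
Proof.
move=> q0 atb ban; have [-> _] := log_threshold_sqr q0 atb ban.
by rewrite /seg_cost (rss_split v atb); ring.
Qed.

End Contrasts.

Section SwapArithmetic.
Context (R : realType).

(** Dimensionless form of an unprofitable swap.  T, c, e are the threshold, the
    data contrast and the signal contrast at the current entry, T', c', e' the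
    same at the candidate.  P is the ratio of the weights of the two positions,
    so that T' ^ 2 - T ^ 2 = 2 ln (1 / P).  After multiplication by P, the
    logarithm costs at most 2 (1 - P), which is negligible compared with T ^ 2,
    and T is itself negligible compared with |e| because L is large: as K >= 324,
    4 T <= |e| / 80, and (81 / 80) ^ 2 <= 33 / 32. *)
Lemma swap_energy (K L T T' c c' e e' P : R) :
  4 * 81 <= K -> K ^+ 2 <= L -> 0 <= T -> 0 <= T' -> 2 * (8 * 8) <= T ^+ 2 -> 0 < P ->
  `|c - e| <= 2 * T -> `|c' - e'| <= 2 * T' ->
  L * T ^+ 2 <= c ^+ 2 -> c' ^+ 2 <= c ^+ 2 + L * (T' ^+ 2 - T ^+ 2) ->
  P * (T' ^+ 2 - T ^+ 2) <= 2 * (1 - P) ->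
  P * e' ^+ 2 <= 33 / 32 * (P + 1 / (8 * 8)) * e ^+ 2 /\ e != 0.
Proof.
move=> K1 L0 T0 T'0 T2 P0 ce ce' Tc cc' PT.
have Tpos : 0 < T by rewrite lt_neqAle T0 andbT; apply: contraTneq T2 => <-; rewrite expr0n/=; lra.
have K0 : 0 <= K by lra.
have cT : 4 * 81 * T <= `|c|.
  apply: (le_trans (ler_wpM2r T0 K1)).
  rewrite -(@ler_pXn2r _ 2)// ?nnegrE ?mulr_ge0// exprMn real_normK ?num_real//.
  by apply: le_trans Tc; apply: ler_wpM2r; rewrite ?sqr_ge0.
clear K1 K0.
have eT : 4 * 80 * T <= `|e|.
  have : `|c| <= `|c - e| + `|e| by rewrite -{1}(subrK e c) ler_normD.
  by lra.
split; last by rewrite -normr_gt0; apply: lt_le_trans eT; lra.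
(* u bounds both |c'| / |c| and T' / T. *)
pose D := P + 1 / (8 * 8); pose u := Num.sqrt (D / P).
have D0 : 0 < D by rewrite /D; lra.
have u0 : 0 <= u by exact: sqrtr_ge0.
have u2 : u ^+ 2 = D / P by rewrite sqr_sqrtr// divr_ge0// ltW.
have uT : T' <= u * T.
  rewrite -(@ler_pXn2r _ 2)// ?nnegrE ?mulr_ge0// exprMn u2.
  rewrite mulrAC ler_pdivlMr// /D; nra.
have uc : `|c'| <= u * `|c|.
  rewrite -(@ler_pXn2r _ 2)// ?nnegrE ?mulr_ge0// exprMn u2 !real_normK ?num_real//.
  rewrite mulrAC ler_pdivlMr// /D.
  have L0' : 0 <= L by apply: le_trans L0; exact: sqr_ge0.
  have := ler_wpM2l (ltW P0) cc'.
  have := ler_wpM2l L0' PT.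
  have := ler_wpM2l L0' T2.
  have : 0 <= L * P by rewrite mulr_ge0// ltW.
  by lra.
have [k [k0 k1 k2]] : exists k : R, [/\ 0 <= k, 1 + 1 / 80 <= k & k ^+ 2 <= 33 / 32].
  by exists (81 / 80); split; lra.
have ee' : `|e'| <= u * (k * `|e|).
  have h1 : `|e'| <= `|c' - e'| + `|c'| by rewrite addrC -{1}(subKr c' e') ler_normB.
  have h2 : `|c| <= `|c - e| + `|e| by rewrite -{1}(subrK e c) ler_normD.
  have h3 : `|e'| <= u * (`|c| + 2 * T) by lra.
  apply: (le_trans h3); apply: ler_wpM2l => //.
  by have := ler_wpM2r (normr_ge0 e) k1; lra.
have e'2 : e' ^+ 2 <= D / P * (k * `|e|) ^+ 2.
  rewrite -u2 -exprMn -(real_normK (num_real e')) ler_pXn2r ?nnegrE//.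
  by rewrite !mulr_ge0.
have := ler_wpM2l (ltW P0) e'2.
have -> : P * (D / P * (k * `|e|) ^+ 2) = D * (k * `|e|) ^+ 2.
  by field; rewrite gt_eqF.
move=> h; apply: (le_trans h); rewrite -/D exprMn real_normK ?num_real//.
have := ler_wpM2l (mulr_ge0 (ltW D0) (sqr_ge0 e)) k2.
by lra.
Qed.

End SwapArithmetic.

Section Consequences.
Context (R : realType) (n : nat) (n_gt0 : (0 < n)%N).
Variables (L q : R) (theta e : 'rV[R]_n) (tau : seq nat).
Hypothesis q_ge : 5 * 60 <= q.
Hypothesis noise_le : forall t1 t2 t3, in_T3 n t1 t2 t3 ->
  `|noise_stat e t1 t2 t3| <= 2 * log_threshold n q t1 t2 t3.
Hypothesis tau_min : is_pls_estimate L q (theta + e) tau.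

Let q0 : 0 <= q. Proof. by move: q_ge; lra. Qed.

Let Y := theta + e.
Let thr := log_threshold n q.

Lemma adjacent_bounds s1 s2 m : rcons tau n.+1 = s1 ++ m ++ s2 ->
  path ltn (last 1%N s1) (m ++ s2) /\ (1 <= last 1%N s1)%N /\
  forall z, z \in m ++ s2 -> (z <= n.+1)%N.
Proof.
move=> E; case: tau_min => tauP _.
have := tauP; rewrite is_cpvecE// E cat_path => /andP[p1 p2]; split=> //.
have all1 : all (ltn 1) s1 by apply: (order_path_min ltn_trans).
split.
  by case/lastP: (s1) all1 => // s x; rewrite all_rcons last_rcons => /andP[/ltnW].
move=> z zs; have : z \in rcons tau n.+1 by rewrite E mem_cat zs orbT.
rewrite mem_rcons inE => /predU1P[->//|]; move: tauP => /andP[_ /allP H] /H.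
by case/andP=> _ /leqW.
Qed.

Lemma kept_contrast s1 a r s2 : rcons tau n.+1 = s1 ++ a :: r :: s2 ->
  L * thr (last 1%N s1) a r ^+ 2 <= noise_stat Y (last 1%N s1) a r ^+ 2.
Proof.
move=> E; have [] := @adjacent_bounds s1 (r :: s2) [:: a] E.
set p := last 1%N s1; rewrite /= => /and3P[pa ar _] [p1 /(_ r)].
rewrite !inE eqxx orbT => /(_ isT) rn.
have := @local_minimality R n n_gt0 L q Y tau s1 [:: a] [::] r s2 tau_min E.
rewrite -/p /= (ltn_trans pa ar) => /(_ isT).
rewrite !addr0 seg_cost_split//; [|by rewrite pa|lia].
by rewrite /thr; lra.
Qed.

Lemma inserted_contrast s1 r s2 t : rcons tau n.+1 = s1 ++ r :: s2 ->
  (last 1%N s1 < t < r)%N ->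
  noise_stat Y (last 1%N s1) t r ^+ 2 <= L * thr (last 1%N s1) t r ^+ 2.
Proof.
move=> E; have [] := @adjacent_bounds s1 (r :: s2) [::] E.
set p := last 1%N s1; rewrite /= => _ [p1 /(_ r)].
rewrite inE eqxx => /(_ isT) rn /andP[pt tr].
have := @local_minimality R n n_gt0 L q Y tau s1 [::] [:: t] r s2 tau_min E.
rewrite -/p /= pt tr => /(_ isT).
rewrite !addr0 seg_cost_split//; [|by rewrite pt|lia].
by rewrite /thr; lra.
Qed.

Lemma swapped_contrast s1 a r s2 t : rcons tau n.+1 = s1 ++ a :: r :: s2 ->
  (last 1%N s1 < t < r)%N ->
  noise_stat Y (last 1%N s1) t r ^+ 2 <= noise_stat Y (last 1%N s1) a r ^+ 2 +
     L * (thr (last 1%N s1) t r ^+ 2 - thr (last 1%N s1) a r ^+ 2).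
Proof.
move=> E; have [] := @adjacent_bounds s1 (r :: s2) [:: a] E.
set p := last 1%N s1; rewrite /= => /and3P[pa ar _] [p1 /(_ r)].
rewrite !inE eqxx orbT => /(_ isT) rn /andP[pt tr].
have := @local_minimality R n n_gt0 L q Y tau s1 [:: a] [:: t] r s2 tau_min E.
rewrite -/p /= pt tr => /(_ isT).
rewrite !addr0 !seg_cost_split//; [|by rewrite ?pt ?pa|lia|by rewrite ?pt ?pa|lia].
by rewrite /thr; lra.
Qed.

Lemma noise_stat_close p t r : (1 <= p)%N -> (p < t < r)%N -> (r <= n.+1)%N ->
  `|noise_stat Y p t r - noise_stat theta p t r| <= 2 * thr p t r.
Proof.
move=> p1 /andP[pt tr] rn; rewrite /Y noise_statD addrAC subrr add0r.
by apply: noise_le; rewrite /in_T3 p1 pt tr.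
Qed.

(** [swap_energy] in terms of the bridge on [p, r]: the weights that relate
    bridge and contrast cancel against the factor P. *)
Lemma swap_bridge K s1 a r s2 t : 4 * 81 <= K -> K ^+ 2 <= L ->
  rcons tau n.+1 = s1 ++ a :: r :: s2 -> let p := last 1%N s1 in
  (p < t < r)%N ->
  bridge theta p t r ^+ 2 <= 33 / 32 *
     ((t - p)%N%:R * (r - t)%N%:R / ((a - p)%N%:R * (r - a)%N%:R) + 1 / (8 * 8)) *
     bridge theta p a r ^+ 2 /\ bridge theta p a r != 0.
Proof.
move=> K1 L0 E p ptr; have /andP[pt tr] := ptr.
have [] := @adjacent_bounds s1 (r :: s2) [:: a] E.
rewrite -/p /= => /and3P[pa ar _] [p1 /(_ r)].
rewrite !inE eqxx orbT => /(_ isT) rn.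
have par : (p < a < r)%N by rewrite pa.
have rpn : (r - p <= n)%N by lia.
pose P : R := (t - p)%N%:R * (r - t)%N%:R / ((a - p)%N%:R * (r - a)%N%:R).
have x0 : 0 < (t - p)%N%:R :> R by rewrite ltr0n subn_gt0.
have y0 : 0 < (r - t)%N%:R :> R by rewrite ltr0n subn_gt0.
have z0 : 0 < (a - p)%N%:R :> R by rewrite ltr0n subn_gt0.
have w0 : 0 < (r - a)%N%:R :> R by rewrite ltr0n subn_gt0.
have s0 : 0 < (r - p)%N%:R :> R by rewrite ltr0n subn_gt0 (ltn_trans pt).
have N0 : 0 < n%:R :> R by rewrite ltr0n.
have P0 : 0 < P by rewrite divr_gt0 ?mulr_gt0.
have PT : P * (thr p t r ^+ 2 - thr p a r ^+ 2) <= 2 * (1 - P).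
  have [-> _] := log_threshold_sqr q0 ptr rpn.
  have [-> _] := log_threshold_sqr q0 par rpn.
  have E1 : ln (n%:R / (t - p)%N%:R) + ln (n%:R / (r - t)%N%:R) -
     (ln (n%:R / (a - p)%N%:R) + ln (n%:R / (r - a)%N%:R)) = ln P^-1 :> R.
    rewrite -!lnM ?posrE ?divr_gt0// -ln_div ?posrE ?mulr_gt0 ?invr_gt0//.
    by congr ln; rewrite /P; field; rewrite !gt_eqF.
  have E2 : ln P^-1 <= P^-1 - 1.
    by have := @le_ln1Dx R (P^-1 - 1); rewrite addrCA subrr addr0; apply; rewrite ltrBDl subrr invr_gt0.
  have := ler_wpM2l (ltW P0) E2; rewrite mulrBr mulfV ?gt_eqF// mulr1.
  by rewrite -E1; lra.
have [_ [T200 _ _]] := log_threshold_sqr q0 par rpn.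
have [] := @swap_energy R K L (thr p a r) (thr p t r) (noise_stat Y p a r) (noise_stat Y p t r)
   (noise_stat theta p a r) (noise_stat theta p t r) P K1 L0 (sqrtr_ge0 _) (sqrtr_ge0 _) _ P0
   (noise_stat_close p1 par rn) (noise_stat_close p1 ptr rn)
   (kept_contrast E) (swapped_contrast E ptr) PT.
  by apply: le_trans T200; move: q_ge; lra.
rewrite -[noise_stat theta p a r == 0]sqrf_eq0 !noise_stat_sqr// => H nz.
split; last by apply: contra_neq nz => ->; rewrite expr0n/= !mul0r.
rewrite -/P.
rewrite -(@ler_pM2r _ ((r - p)%N%:R / ((a - p)%N%:R * (r - a)%N%:R))); last first.
  by rewrite divr_gt0 ?mulr_gt0.
move: H; rewrite [leLHS](_ : _ = bridge theta p t r ^+ 2 *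
   ((r - p)%N%:R / ((a - p)%N%:R * (r - a)%N%:R))).
  by rewrite -!mulrA.
by rewrite /P; field; rewrite !gt_eqF.
Qed.

End Consequences.

(** * At most one estimated change-point per cell *)

Section SwapGeometry.
Context (R : realType).

(** Both sides are affine in w, and the inequality holds coefficientwise.  The
    coefficient of w becomes a polynomial with nonnegative coefficients in x,
    y - x and z - y. *)
Lemma complex_swap_weight (x y z w : R) :
  0 < x -> x <= y -> y <= z -> 0 < w ->
  z ^+ 2 * (x * (y + z + w)) + 4 / 5 * y * (z - y / 4) * ((x + y + z) * w) <=
  47 / 50 * ((y + z) * (z - y / 4)) * ((x + y) * (z + w)).
Proof.
move=> x0 xy yz w0.
have D0 : z ^+ 2 * (x * (y + z)) <= 47 / 50 * ((y + z) * (z - y / 4)) * ((x + y) * z).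
  have h1 : 3 / 4 * z * (2 * x) <= (z - y / 4) * (x + y) by apply: ler_pM; nra.
  have h2 : 0 <= z * (y + z) by nra.
  have h3 : 0 <= z * (y + z) * (x * z) by apply: mulr_ge0 => //; nra.
  have := ler_wpM2l h2 h1; lra.
have D1 : z ^+ 2 * x + 4 / 5 * y * (z - y / 4) * (x + y + z) <=
    47 / 50 * ((y + z) * (z - y / 4)) * (x + y).
  have [i [i0 yE]] : exists i, 0 <= i /\ y = x + i by exists (y - x); split; lra.
  have [j [j0 zE]] : exists j, 0 <= j /\ z = x + i + j by exists (z - x - i); split; lra.
  rewrite zE yE.
  have X := ltW x0.
  have := mulr_ge0 (mulr_ge0 i0 j0) j0; have := mulr_ge0 (mulr_ge0 i0 i0) j0.
  have := mulr_ge0 (mulr_ge0 i0 i0) i0; have := mulr_ge0 (mulr_ge0 X j0) j0.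
  have := mulr_ge0 (mulr_ge0 X i0) j0; have := mulr_ge0 (mulr_ge0 X i0) i0.
  have := mulr_ge0 (mulr_ge0 X X) j0; have := mulr_ge0 (mulr_ge0 X X) i0.
  have := mulr_ge0 (mulr_ge0 X X) X.
  lra.
have := ler_wpM2l (ltW w0) D1; lra.
Qed.

(** x, y, z, w are the lengths of [p, t), [t, a), [a, u), [u, r) and ft, fb, fu
    the values of the bridge at t, a, u.  The hypothesis on fb is the affinity of
    the bridge on [t, u).  With the weight 5 l / 4 in place of the natural weight
    l = y / (y + z), Cauchy-Schwarz bounds fb ^ 2 by a combination of ft ^ 2 and
    fu ^ 2 that stays below 47 / 50 fb ^ 2 for all lengths; the natural weight
    only gives 1 in the limit of large w. *)
Lemma complex_swap (x y z w ft fb fu : R) :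
  0 < x -> x <= y -> y <= z -> 0 < w -> (y + z) * fb = z * ft + y * fu ->
  ft ^+ 2 <= 33 / 32 * (x * (y + z + w) / ((x + y) * (z + w)) + 1 / (8 * 8)) * fb ^+ 2 ->
  fu ^+ 2 <= 33 / 32 * ((x + y + z) * w / ((x + y) * (z + w)) + 1 / (8 * 8)) * fb ^+ 2 ->
  fb = 0.
Proof.
move=> x0 xy yz w0 fE.
set P1 := x * _ / _; set P2 := (x + y + z) * w / _ => H1 H2.
have y0 : 0 < y by lra.
have z0 : 0 < z by lra.
have s0 : 0 < y + z by lra.
have v0 : 0 < z - y / 4 by lra.
pose A1 := z ^+ 2 / ((y + z) * (z - y / 4)); pose A2 := 4 / 5 * (y / (y + z)).
have A1_ge0 : 0 <= A1 by rewrite divr_ge0 ?mulr_ge0 ?sqr_ge0// ltW.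
have yz0 : 0 <= y / (y + z) by rewrite divr_ge0// ltW.
have A2_ge0 : 0 <= A2 by rewrite /A2; lra.
have A1_le : A1 <= 1.
  rewrite ler_pdivrMr ?mulr_gt0// mul1r; nra.
have A2_le : A2 <= 2 / 5.
  have : y / (y + z) <= 1 / 2 by rewrite ler_pdivrMr//; lra.
  by rewrite /A2; lra.
have wt : A1 * P1 + A2 * P2 <= 47 / 50.
  have xy0 : 0 < x + y by lra.
  have zw0 : 0 < z + w by lra.
  have -> : A1 * P1 + A2 * P2 =
     (z ^+ 2 * (x * (y + z + w)) + 4 / 5 * y * (z - y / 4) * ((x + y + z) * w)) /
     ((y + z) * (z - y / 4) * ((x + y) * (z + w))).
    rewrite /A1 /A2 /P1 /P2; field.
    by rewrite !gt_eqF// -?[_ * z]mulr_natl; lra.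
  rewrite ler_pdivrMr ?mulr_gt0//.
  by have := complex_swap_weight x0 xy yz w0; lra.
have cs : fb ^+ 2 <= A1 * ft ^+ 2 + A2 * fu ^+ 2.
  have -> : A1 * ft ^+ 2 + A2 * fu ^+ 2 =
    fb ^+ 2 + (z * (5 / 4 * y) * ft - y * (z - y / 4) * fu) ^+ 2 /
              ((y + z) ^+ 2 * (z - y / 4) * (5 / 4 * y)).
    have -> : fb = (z * ft + y * fu) / (y + z) by rewrite -fE mulrAC mulfV ?mul1r ?gt_eqF.
    by rewrite /A1 /A2; field; rewrite !gt_eqF//; lra.
  rewrite lerDl divr_ge0 ?sqr_ge0// !mulr_ge0 ?sqr_ge0 ?ltW//; lra.
have fb2 := sqr_ge0 fb.
have h1 := ler_wpM2l A1_ge0 H1.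
have h2 := ler_wpM2l A2_ge0 H2.
have h3 := ler_wpM2r fb2 wt.
have h4 := ler_wpM2r fb2 A1_le.
have h5 := ler_wpM2r fb2 A2_le.
have : fb ^+ 2 <= 0 by lra.
by move=> le0; apply/eqP; rewrite -sqrf_eq0 eq_le le0 fb2.
Qed.

(** Here the bridge vanishes at the far end of the plateau, at distance w from
    the entry and z from the candidate, so that the values are in the ratio
    w / z.  The hypothesis 2 x w <= z y leaves a factor 2 of slack. *)
Lemma simple_swap (x y z w fs fa : R) :
  0 < x -> 0 < y -> 0 < z -> 0 < w -> 2 * x * w <= z * y -> w <= z ->
  z * fa = w * fs ->
  fs ^+ 2 <= 33 / 32 * (x * z / (y * w) + 1 / (8 * 8)) * fa ^+ 2 ->
  fa = 0.
Proof.
move=> x0 y0 z0 w0 xw wz fE H.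
pose rho := z / w.
have fsE : fs = rho * fa by rewrite /rho mulrAC fE mulrAC mulfV ?mul1r ?gt_eqF.
have r1 : 1 <= rho by rewrite ler_pdivlMr// mul1r.
have P_le : x * z / (y * w) <= rho ^+ 2 / 2.
  have -> : rho ^+ 2 / 2 = (z * y) / 2 * z / (y * w) / w.
    by rewrite /rho; field; rewrite !gt_eqF.
  rewrite ler_pdivlMr// mulrAC ler_pM2r ?invr_gt0 ?mulr_gt0//.
  by have := ler_wpM2r (ltW z0) xw; lra.
have rr : 1 <= rho ^+ 2 by rewrite expr_ge1// (le_trans ler01).
have := ler_wpM2r (sqr_ge0 fa) P_le; have := ler_wpM2r (sqr_ge0 fa) rr.
move: H; rewrite fsE exprMn => h1 h2 h3.
have : fa ^+ 2 <= 0 by lra.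
by move=> le0; apply/eqP; rewrite -sqrf_eq0 eq_le le0 sqr_ge0.
Qed.

Context (n : nat).
Implicit Types v : 'rV[R]_n.

Definition plateau v (a b : nat) (m : R) : Prop :=
  forall c d, (a <= c <= d)%N -> (d <= b)%N ->
    psum v d - psum v c = (d - c)%N%:R * m.

Lemma plateau_sub v a b a' b' m :
  (a <= a')%N -> (b' <= b)%N -> plateau v a b m -> plateau v a' b' m.
Proof. by move=> aa bb H c d cd db; apply: H; lia. Qed.

Lemma bridge_affine v p r x t y m : (p <= x <= t)%N -> (t <= y <= r)%N -> (p < r)%N ->
  psum v t - psum v x = (t - x)%N%:R * m -> psum v y - psum v t = (y - t)%N%:R * m ->
  (y - x)%N%:R * bridge v p t r =
  (y - t)%N%:R * bridge v p x r + (t - x)%N%:R * bridge v p y r.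
Proof.
move=> /andP[px xt] /andP[ty yr] pr /eqP; rewrite subr_eq => /eqP E1 /eqP.
rewrite subr_eq E1 => /eqP E2; rewrite /bridge E1 E2.
rewrite !natrB//; [|lia..].
have : 0 < r%:R - p%:R :> R by rewrite subr_gt0 ltr_nat.
by move=> h; field; rewrite gt_eqF.
Qed.

Lemma bridge_left v p r : bridge v p p r = 0.
Proof. by rewrite /bridge subrr subnn !mul0r subr0. Qed.

Lemma bridge_right v p r : (p < r)%N -> bridge v p r r = 0.
Proof.
by move=> pr; rewrite /bridge divff ?mul1r ?subrr// pnatr_eq0 -lt0n subn_gt0.
Qed.

End SwapGeometry.

Section TrueSignal.
Context (R : realType) (n : nat) (n_gt0 : (0 < n)%N).
Variables (K : nat) (theta : 'rV[R]_n) (taus : seq nat) (mu : nat -> R).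
Hypothesis thetaP : in_Theta K theta taus mu.

Lemma theta_plateau k : (1 <= k <= K.+1)%N ->
  plateau theta (cpt n taus k.-1) (cpt n taus k) (mu k).
Proof.
case: thetaP => tP sK _ H kK c d /andP[kc cd] dk.
rewrite -psum_seg// (eq_bigr (fun i => mu k * 1)).
  rewrite -mulr_sumr sum1_seg ?(leq_trans dk (cpt_max n_gt0 tP k))// 1?mulrC//.
  by rewrite cd (leq_trans _ kc)// cpt_ge1.
move=> i /andP[ci id]; rewrite mulr1; apply: H => //.
by rewrite /in_seg (leq_trans kc ci) prednK ?(leq_trans id dk)//; case/andP: kK.
Qed.

Lemma true_lt k : (1 <= k <= K)%N ->
  (cpt n taus k.-1 < cpt n taus k < cpt n taus k.+1)%N.
Proof.
case: thetaP => tP sK _ _ /andP[k1 kK].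
by rewrite !cpt_lt// ?sK ?prednK//; lia.
Qed.

Lemma true_range k : (1 <= k <= K)%N -> (1 < cpt n taus k <= n)%N.
Proof.
case: thetaP => tP sK _ _ /andP[k1 kK]; apply/andP; split.
  by rewrite -[1%N](cpt0 n taus) cpt_lt// leqW// sK.
by rewrite -ltnS -[n.+1](cpt_last n taus) cpt_lt ?sK.
Qed.

End TrueSignal.

Section NoSpurious.
Context (R : realType) (n : nat) (n_gt0 : (0 < n)%N).
Variables (L K0 q : R) (theta e : 'rV[R]_n) (tau : seq nat).
Hypothesis q_ge : 5 * 60 <= q.
Hypothesis K0_ge : 4 * 81 <= K0.
Hypothesis L_ge : K0 ^+ 2 <= L.
Hypothesis noise_le : forall t1 t2 t3, in_T3 n t1 t2 t3 ->
  `|noise_stat e t1 t2 t3| <= 2 * log_threshold n q t1 t2 t3.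
Hypothesis tau_min : is_pls_estimate L q (theta + e) tau.

Lemma swap_left_plateau s1 a b s2 t m : rcons tau n.+1 = s1 ++ a :: b :: s2 ->
  let p := last 1%N s1 in
  (p < t < a)%N -> (2 * (t - p) * (b - a) <= (b - t) * (a - p))%N ->
  plateau theta t b m -> False.
Proof.
move=> E p /andP[pt ta] X aff.
have [/= /and3P[pa ab _] _] := @adjacent_bounds _ _ n_gt0 _ _ _ _ _ tau_min s1 (b :: s2) [:: a] E.
rewrite -/p in pa.
have [|H /eqP] := swap_bridge n_gt0 q_ge noise_le tau_min K0_ge L_ge E (t := t).
  by rewrite -/p pt; lia.
rewrite -/p in H *; apply.
have := @bridge_affine R n theta p b t a b m ltac:(lia) ltac:(lia) ltac:(lia) (aff t a ltac:(lia) ltac:(lia)) (aff a b ltac:(lia) ltac:(lia)).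
rewrite bridge_right ?mulr0 ?addr0; last lia.
move=> fE; apply: (simple_swap _ _ _ _ _ _ fE H); rewrite ?ltr0n ?subn_gt0 ?ler_nat//; try lia.
by rewrite -!natrM ler_nat.
Qed.

Lemma swap_right_plateau s1 a b s2 t m : rcons tau n.+1 = s1 ++ a :: b :: s2 ->
  let p := last 1%N s1 in
  (a < t < b)%N -> (2 * (b - t) * (a - p) <= (t - p) * (b - a))%N ->
  plateau theta p t m -> False.
Proof.
move=> E p /andP[at_ tb] X aff.
have [/= /and3P[pa ab _] _] := @adjacent_bounds _ _ n_gt0 _ _ _ _ _ tau_min s1 (b :: s2) [:: a] E.
rewrite -/p in pa.
have [|H /eqP] := swap_bridge n_gt0 q_ge noise_le tau_min K0_ge L_ge E (t := t).
  by rewrite -/p tb; lia.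
rewrite -/p in H *; apply.
have := @bridge_affine R n theta p b p a t m ltac:(lia) ltac:(lia) ltac:(lia) (aff p a ltac:(lia) ltac:(lia)) (aff a t ltac:(lia) ltac:(lia)).
rewrite bridge_left ?mulr0 ?add0r => fE.
rewrite [(t - p)%N%:R * _]mulrC [(a - p)%N%:R * _]mulrC in H.
apply: (simple_swap _ _ _ _ _ _ fE H); rewrite ?ltr0n ?subn_gt0 ?ler_nat//; try lia.
by rewrite -!natrM ler_nat.
Qed.

Lemma no_plateau s1 a b s2 m : rcons tau n.+1 = s1 ++ a :: b :: s2 ->
  let p := last 1%N s1 in
  plateau theta p b m -> False.
Proof.
move=> E p aff.
have [/= /and3P[pa ab _] _] := @adjacent_bounds _ _ n_gt0 _ _ _ _ _ tau_min s1 (b :: s2) [:: a] E.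
rewrite -/p in pa.
have [|_ /eqP] := swap_bridge n_gt0 q_ge noise_le tau_min K0_ge L_ge E (t := a).
  by rewrite -/p pa.
rewrite -/p; apply.
have := @bridge_affine R n theta p b p a b m ltac:(lia) ltac:(lia) ltac:(lia) (aff p a ltac:(lia) ltac:(lia)) (aff a b ltac:(lia) ltac:(lia)).
rewrite bridge_left bridge_right ?mulr0 ?add0r; last lia.
move=> /eqP; rewrite mulf_eq0 pnatr_eq0 => /predU1P[|/eqP//]; lia.
Qed.

(* t and u are the two ends of the plateau that contains a. *)
Lemma swap_either_end s1 a b s2 t u m : rcons tau n.+1 = s1 ++ a :: b :: s2 ->
  let p := last 1%N s1 in
  (p < t < a)%N -> (a < u < b)%N ->
  (t - p <= a - t <= u - a)%N || (b - u <= u - a <= a - t)%N ->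
  plateau theta t u m -> False.
Proof.
move=> E p /andP[pt ta] /andP[au ub] X aff.
have [|H1 /eqP] := swap_bridge n_gt0 q_ge noise_le tau_min K0_ge L_ge E (t := t).
  by rewrite -/p pt; lia.
have [|H2 _] := swap_bridge n_gt0 q_ge noise_le tau_min K0_ge L_ge E (t := u).
  by rewrite -/p ub; lia.
rewrite -/p in H1 H2 *; apply.
have := @bridge_affine R n theta p b t a u m ltac:(lia) ltac:(lia) ltac:(lia) (aff t a ltac:(lia) ltac:(lia)) (aff a u ltac:(lia) ltac:(lia)).
have d1 : (0 < t - p)%N by rewrite subn_gt0.
have d2 : (0 < b - u)%N by rewrite subn_gt0.
have e1 : (b - t = (a - t) + (u - a) + (b - u))%N by lia.
have e2 : (a - p = (t - p) + (a - t))%N by lia.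
have e3 : (b - a = (u - a) + (b - u))%N by lia.
have e4 : (u - p = (t - p) + (a - t) + (u - a))%N by lia.
have e5 : (u - t = (a - t) + (u - a))%N by lia.
rewrite e1 e2 e3 ?natrD in H1; rewrite e2 e3 e4 ?natrD in H2; rewrite e5 natrD.
case/orP: X => /andP[X1 X2] fE.
  by apply: (complex_swap _ _ _ _ fE H1 H2); rewrite ?ltr0n ?ler_nat.
apply: (@complex_swap R (b - u)%N%:R (u - a)%N%:R (a - t)%N%:R (t - p)%N%:R
  (bridge theta p u b) (bridge theta p a b) (bridge theta p t b));
  rewrite ?ltr0n ?ler_nat//.
- by rewrite addrC fE addrC.
- move: H2; congr (_ <= 33 / 32 * (_ + _) * _); congr (_ / _); ring.
- move: H1; congr (_ <= 33 / 32 * (_ + _) * _); congr (_ / _); ring.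
Qed.

(** s < t < u are consecutive true change-points and a, b the two entries.  The
    last two hypotheses hold either because p >= s (resp. r <= u) or because the
    entries are on the side of t of the midpoints.  If a and b lie on the same
    side of t, the entry farther from t is moved to the true change-point beyond
    it.  If t separates them, the entry farther from t is moved, to t or to
    the true change-point on its own side. *)
Lemma no_adjacent_in_cell s1 a b r s2 s t u m1 m2 :
  rcons tau n.+1 = s1 ++ a :: b :: r :: s2 ->
  (s < a)%N -> (b < u)%N -> (s < t < u)%N ->
  plateau theta s t m1 -> plateau theta t u m2 ->
  (s <= last 1 s1)%N || (s + t <= 2 * a)%N ->
  (r <= u)%N || (2 * b <= t + u)%N -> False.
Proof.
move=> E sa bu /andP[st tu] H1 H2.
have E' : rcons tau n.+1 = rcons s1 a ++ b :: r :: s2 by rewrite cat_rcons.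
have [/= /and3P[pa ab /andP[br _]] _] :=
  @adjacent_bounds _ _ n_gt0 _ _ _ _ _ tau_min s1 (b :: r :: s2) [:: a] E.
have swapL := swap_left_plateau E; have swapR := swap_right_plateau E.
have flatL := no_plateau E; have endL := swap_either_end E.
have swapL' := swap_left_plateau E'; have swapR' := swap_right_plateau E'.
have flatR := no_plateau E'; have endR := swap_either_end E'.
move: pa swapL swapR flatL endL swapL' swapR' flatR endR; rewrite !last_rcons /=.
move: (last 1%N s1) => p pa swapL swapR flatL endL swapL' swapR' flatR endR HL HR.
case: (leqP b t) => [bt|tb].
  case: (leqP s p) HL => [sp _|ps /= X].
    by apply: flatL; apply: plateau_sub sp bt H1.
  apply: (swapL s m1); [by rewrite ps|nia|exact: plateau_sub (leqnn _) bt H1].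
case: (leqP t a) => [ta|at_].
  case: (leqP r u) HR => [ru _|ur /= X].
    by apply: flatR; apply: plateau_sub ta ru H2.
  apply: (swapR' u m2); [by rewrite bu|nia|exact: plateau_sub ta (leqnn _) H2].
case: (leqP (t - a) (b - t)) => [le_at|lt_at].
  case: (leqP r u) HR => [ru _|ur /= X].
    apply: (swapL' t m2); [by rewrite at_|nia|exact: plateau_sub (leqnn _) ru H2].
  apply: (endR t u m2) => //; [by rewrite at_|by rewrite bu|lia].
case: (leqP s p) HL => [sp _|ps /= X].
  apply: (swapR t m1); [by rewrite at_|nia|exact: plateau_sub sp (leqnn _) H1].
apply: (endL s t m1) => //; [by rewrite ps|by rewrite at_|lia].
Qed.

End NoSpurious.

(** Two entries in a convex set may be chosen consecutive. *)
Lemma adjacent_pair (C : pred nat) (l : seq nat) :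
  (forall a b c, (a <= b <= c)%N -> C a -> C c -> C b) ->
  sorted ltn l -> (1 < count C l)%N ->
  exists s1 a b s2, [/\ l = s1 ++ a :: b :: s2, C a & C b].
Proof.
move=> conv; elim: l => [//|x l IH] /= pl.
case Cx: (C x) => /=; last first.
  rewrite add0n => /(IH (path_sorted pl))[s1 [a [b [s2 [-> Ca Cb]]]]].
  by exists (x :: s1), a, b, s2.
rewrite add1n ltnS -has_count => /hasP[y yl Cy].
case: l pl yl {IH} => [//|z l] /= /andP[xz zl].
rewrite inE => yl; exists [::], x, z, l; split=> //.
apply: (conv x z y) => //; rewrite (ltnW xz)/=.
case/predU1P: yl => [->//|yl]; apply: ltnW.
by move: (order_path_min ltn_trans zl) => /allP/(_ _ yl).
Qed.

Lemma gap_around (t x : nat) (l : seq nat) :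
  (x < t)%N -> t \notin l -> (t < last x l)%N ->
  exists s1 r s2, l = s1 ++ r :: s2 /\ (last x s1 < t < r)%N.
Proof.
elim: l x => [x xt _ /=|y l IH x xt /=]; first by rewrite ltnNge ltnW.
rewrite inE negb_or => /andP[ty tl] tlast.
case: (ltngtP y t) ty => [yt _|ty _|//].
  have [s1 [r [s2 [-> h]]]] := IH y yt tl tlast.
  by exists (y :: s1), r, s2.
by exists [::], y, l; split=> //=; rewrite xt.
Qed.

Lemma insert_cptE (s1 s2 : seq nat) t x : path ltn x (s1 ++ t :: s2) ->
  insert_cpt (s1 ++ s2) t = s1 ++ t :: s2.
Proof.
move=> p; apply: (sorted_eq leq_trans anti_leq).
- exact/sort_sorted/leq_total.
- by apply: (sub_sorted (fun _ _ => @ltnW _ _)); exact: path_sorted p.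
- rewrite /insert_cpt perm_sort -cats1 -catA perm_cat2l.
  by rewrite perm_catC.
Qed.

Lemma gap_around_missing n (tau : seq nat) t : (1 < t <= n)%N -> t \notin tau ->
  exists s1 r s2, [/\ rcons tau n.+1 = s1 ++ r :: s2,
    (last 1 s1 < t < r)%N, last 1%N s1 \in 1%N :: tau & r \in rcons tau n.+1].
Proof.
move=> /andP[t1 tn] tN.
have [||s1 [r [s2 [E h]]]] := @gap_around t 1 (rcons tau n.+1) t1.
- by rewrite mem_rcons inE negb_or tN andbT neq_ltn ltnS tn.
- by rewrite last_rcons.
exists s1, r, s2; split=> //; last by rewrite E mem_cat mem_head orbT.
have := mem_last 1%N s1; rewrite !inE => /orP[->//|ls].
have : last 1%N s1 \in rcons tau n.+1 by rewrite E mem_cat ls.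
rewrite mem_rcons inE => /orP[/eqP E1|->]; last by rewrite orbT.
by case/andP: h; rewrite E1 => h _; move: (leq_trans h tn); rewrite ltnNge leqnSn.
Qed.

Section NoSpuriousTheorem.
Context (R : realType) (n : nat) (n_gt0 : (0 < n)%N).
Variables (L K0 q : R) (theta e : 'rV[R]_n) (tau : seq nat).
Hypothesis q_ge : 5 * 60 <= q.
Hypothesis K0_ge : 4 * 81 <= K0.
Hypothesis L_ge : K0 ^+ 2 <= L.
Hypothesis noise_le : forall t1 t2 t3, in_T3 n t1 t2 t3 ->
  `|noise_stat e t1 t2 t3| <= 2 * log_threshold n q t1 t2 t3.
Hypothesis tau_min : is_pls_estimate L q (theta + e) tau.
Variables (K : nat) (taus : seq nat) (mu : nat -> R).
Hypothesis thetaP : in_Theta K theta taus mu.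


(** The conditions k == 1 and k == K stand for the outer cells, which extend to
    the boundary: there the neighbour cannot lie beyond the adjacent
    change-point. *)
Lemma cell_count k (C : pred nat) : (1 <= k <= K)%N ->
  (forall a b c, (a <= b <= c)%N -> C a -> C c -> C b) ->
  (forall a, C a -> [/\ (cpt n taus k.-1 < a < cpt n taus k.+1)%N,
     (k == 1) || (cpt n taus k.-1 + cpt n taus k <= 2 * a)%N &
     (k == K) || (2 * a <= cpt n taus k + cpt n taus k.+1)%N]) ->
  (count C tau <= 1)%N.
Proof.
move=> kK conv H; rewrite leqNgt; apply/negP => c2.
have [tP _] := tau_min.
have [s1 [a [b [s2 [E Ca Cb]]]]] := adjacent_pair conv (proj1 (andP tP)) c2.
have [r [s3 rE]] : exists r s3, rcons s2 n.+1 = r :: s3.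
  by case: (s2) => [|z s]; [exists n.+1, [::]|exists z, (rcons s n.+1)].
have E' : rcons tau n.+1 = s1 ++ a :: b :: r :: s3 by rewrite E rcons_cat/= rE.
have [[/andP[sa _] la _] [/andP[_ bu] _ lb]] := (H a Ca, H b Cb).
have k1 : (1 <= k <= K.+1)%N by lia.
have kS : (1 <= k.+1 <= K.+1)%N by lia.
have [_ [p1 rn]] := adjacent_bounds n_gt0 tau_min (m := [:: a; b]) E'.
apply: (no_adjacent_in_cell n_gt0 q_ge K0_ge L_ge noise_le tau_min E' sa bu
  (true_lt n_gt0 thetaP kK) (theta_plateau n_gt0 thetaP k1) (theta_plateau n_gt0 thetaP kS)).
- by case/orP: la => [/eqP->|->]; rewrite ?orbT//= /cpt/= p1.
- case/orP: lb => [/eqP->|->]; rewrite ?orbT//=.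
  have -> : cpt n taus K.+1 = n.+1 by case: thetaP => _ <- _ _; rewrite cpt_last.
  by rewrite rn// !inE eqxx !orbT.
Qed.

Lemma midpoint_lt a b c : (midpoint R a b < c%:R) = (a + b < 2 * c)%N.
Proof. by rewrite /midpoint ltr_pdivrMr// -natrM ltr_nat mulnC. Qed.

Lemma midpoint_ge a b c : (c%:R <= midpoint R a b) = (2 * c <= a + b)%N.
Proof. by rewrite /midpoint ler_pdivlMr// -natrM ler_nat mulnC. Qed.

Lemma no_spurious : (0 < K)%N ->
 [/\ forall k : nat, (2 <= k <= K.-1)%N ->
            (count_in tau
               `](midpoint R (cpt n taus k.-1) (cpt n taus k)),
                 (midpoint R (cpt n taus k) (cpt n taus k.+1))] <= 1)%N,
          (count_in tau
             `[2%:R, (midpoint R (cpt n taus 1) (cpt n taus 2))] <= 1)%N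
        & (count_in tau
             `](midpoint R (cpt n taus K.-1) (cpt n taus K)), n%:R] <= 1)%N].
Proof.
move=> Kpos; split=> [k kK||].
- have kK' : (1 <= k <= K)%N by lia.
  have := true_lt n_gt0 thetaP kK'.
  move=> /andP[h1 h2]; apply: (cell_count kK') => [a b c abc|a];
    rewrite !in_itv/= ?midpoint_lt ?midpoint_ge; first lia.
  by move=> h; split; apply/orP || idtac; lia.
- have kK' : (1 <= 1 <= K)%N by [].
  have /= := true_lt n_gt0 thetaP kK'.
  move=> /andP[h1 h2]; apply: (cell_count kK') => [a b c abc|a];
    rewrite !in_itv/= ?ler_nat ?midpoint_lt ?midpoint_ge; first lia.
  rewrite /cpt /= in h1 h2 *.
  by move=> h; split => //; lia.
- have kK' : (1 <= K <= K)%N by rewrite Kpos leqnn.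
  have /= := true_lt n_gt0 thetaP kK'.
  have uE : cpt n taus K.+1 = n.+1 by case: thetaP => _ <- _ _; rewrite cpt_last.
  rewrite uE.
  move=> /andP[h1 h2]; apply: (cell_count kK') => [a b c abc|a];
    rewrite !in_itv/= ?ler_nat ?midpoint_lt ?midpoint_ge; first lia.
  by rewrite uE eqxx => h; split => //; lia.
Qed.

End NoSpuriousTheorem.

(** * Change-points that the estimate misses *)

Section Missed.
Context (R : realType) (n : nat) (n_gt0 : (0 < n)%N).
Variables (L q : R) (theta e : 'rV[R]_n) (tau : seq nat).
Hypothesis q_ge : 5 * 60 <= q.
Hypothesis L_ge0 : 0 <= L.
Hypothesis noise_le : forall t1 t2 t3, in_T3 n t1 t2 t3 ->
  `|noise_stat e t1 t2 t3| <= 2 * log_threshold n q t1 t2 t3.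
Hypothesis tau_min : is_pls_estimate L q (theta + e) tau.
Variables (K : nat) (taus : seq nat) (mu : nat -> R).
Hypothesis thetaP : in_Theta K theta taus mu.

(** Inserting a missed change-point is not profitable, so the data contrast there
    is at most sqrt L times the threshold, and the noise adds at most 2. *)
Lemma undetected_not_high_energy k : (1 <= k <= K)%N ->
  let tau' := insert_cpt tau (cpt n taus k) in
  cpt n taus k \in tau \/
  ~~ high_energy theta (Num.sqrt L + 2) q tau' (index (cpt n taus k) tau').+1.
Proof.
move=> kK tau'; case: (boolP (cpt n taus k \in tau)) => [|tN]; [by left|right].
have [s1 [r [s2 [E h _ _]]]] := gap_around_missing (true_range n_gt0 thetaP kK) tN.
set t := cpt n taus k in h tN tau' *.
have [pth [p1 rn]] := adjacent_bounds n_gt0 tau_min (m := [::]) E.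
have rn' : (r <= n.+1)%N by apply: rn; rewrite mem_head.
have [z zE] : exists z, rcons z n.+1 = r :: s2.
  have : last 1%N (rcons tau n.+1) = n.+1 by rewrite last_rcons.
  by rewrite E last_cat/= => lE; exists (belast r s2); rewrite -lE -lastI.
have tauE : tau = s1 ++ z.
  by move: E; rewrite -zE -rcons_cat => /rcons_inj[].
have tau'E : tau' = s1 ++ t :: z.
  rewrite /tau' tauE; apply: (@insert_cptE _ _ _ 1%N).
  have : path ltn 1 (s1 ++ t :: rcons z n.+1).
    have [tP _] := tau_min; move: tP; rewrite is_cpvecE// E !cat_path zE/=.
    by case/andP: h => -> ->; case/andP=> -> /andP[_ ->].
  by rewrite -rcons_cons -rcons_cat -cats1 cat_path => /andP[].
have idx : index t tau' = size s1.
  rewrite tau'E index_cat /= eqxx addn0 ifN//.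
  by move: tN; rewrite tauE mem_cat negb_or => /andP[].
rewrite /high_energy idx /= !tau'E.
have -> : cpt n (s1 ++ t :: z) (size s1) = last 1%N s1.
  by rewrite /cpt -cat_cons nth_cat /= ltnS leqnn -last_nth.
have -> : cpt n (s1 ++ t :: z) (size s1).+1 = t.
  by rewrite /cpt /= nth_cat ltnn subnn.
have -> : cpt n (s1 ++ t :: z) (size s1).+2 = r.
  rewrite /cpt /= nth_cat ltnNge leqnSn /= subSnn /=.
  by case: (z) zE => [|w z'] /= [<-].
have c1 := inserted_contrast n_gt0 q_ge tau_min E h.
have c2 := @noise_stat_close _ _ q theta e noise_le _ _ _ p1 h rn'.
have T0 : 0 <= log_threshold n q (last 1%N s1) t r := sqrtr_ge0 _.
rewrite -leNgt energyE.
have c1' : `|noise_stat (theta + e) (last 1%N s1) t r| <=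
    Num.sqrt L * log_threshold n q (last 1%N s1) t r.
  rewrite -(@ler_pXn2r _ 2)// ?nnegrE ?mulr_ge0// exprMn sqr_sqrtr//.
  by rewrite real_normK ?num_real.
have := ler_normB (noise_stat (theta + e) (last 1%N s1) t r)
  (noise_stat (theta + e) (last 1%N s1) t r - noise_stat theta (last 1%N s1) t r).
by rewrite subKr; lra.
Qed.

End Missed.

(** * Detection of high-energy change-points *)

Section Detection.
Context (R : realType).

Lemma rss_super n (v : 'rV[R]_n) p t r : (p <= t <= r)%N ->
  rss v p t + rss v t r <= rss v p r.
Proof.
move=> /andP[]; rewrite leq_eqVlt => /predU1P[->|pt]; first by rewrite rss_nil add0r.
rewrite leq_eqVlt => /predU1P[->|tr]; first by rewrite rss_nil addr0.
by rewrite (@rss_split _ _ v p t r) ?pt// lerDl sqr_ge0.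
Qed.

Lemma plateau_contrast n (v : 'rV[R]_n) p t r m1 m2 : (p < t < r)%N ->
  plateau v p t m1 -> plateau v t r m2 ->
  noise_stat v p t r ^+ 2 =
  (m2 - m1) ^+ 2 * ((t - p)%N%:R * (r - t)%N%:R / (r - p)%N%:R).
Proof.
move=> /andP[pt tr] H1 H2; rewrite /noise_stat !seg_meanE ?(ltnW pt) ?(ltnW tr)//.
have -> := H1 p t _ (leqnn t); last by rewrite leqnn ltnW.
have -> := H2 t r _ (leqnn r); last by rewrite leqnn ltnW.
rewrite exprMn sqr_sqrtr; last by rewrite divr_ge0.
rewrite natrM.
have x0 : (t - p)%N%:R != 0 :> R by rewrite pnatr_eq0 -lt0n subn_gt0.
have y0 : (r - t)%N%:R != 0 :> R by rewrite pnatr_eq0 -lt0n subn_gt0.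
by rewrite ![_%:R * _ / _]mulrAC !mulfV// !mul1r.
Qed.

Lemma window_energy (L q l T c e z : R) :
  0 <= L -> 2 <= q -> 0 <= l -> 0 <= T ->
  `|c - e| <= 2 * T -> c ^+ 2 <= L * (3 * q + 8 * l) -> T ^+ 2 <= q + 2 * l + 2 ->
  e ^+ 2 = z / 2 -> z <= 32 * (L + 1) * (q + l).
Proof.
move=> L0 q2 l0 T0 ce cL T2 eE.
have e2 : e ^+ 2 <= 2 * c ^+ 2 + 8 * T ^+ 2.
  have h : (c - e) ^+ 2 <= 4 * T ^+ 2.
    rewrite -(real_normK (num_real (c - e))).
    have := ler_pM (normr_ge0 _) (normr_ge0 _) ce ce.
    by rewrite -!expr2; lra.
  by have := sqr_ge0 (2 * c - e); lra.
have : L * (3 * q + 8 * l) <= L * (8 * (q + l)) by apply: ler_wpM2l => //; lra.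
lra.
Qed.

Context (n : nat) (n_gt0 : (0 < n)%N).
Variables (L q : R) (theta e : 'rV[R]_n) (tau : seq nat).
Hypothesis q_ge : 5 * 60 <= q.
Hypothesis L_ge0 : 0 <= L.
Hypothesis noise_le : forall t1 t2 t3, in_T3 n t1 t2 t3 ->
  `|noise_stat e t1 t2 t3| <= 2 * log_threshold n q t1 t2 t3.
Hypothesis tau_min : is_pls_estimate L q (theta + e) tau.
Let q0 : 0 <= q. Proof. by move: q_ge; lra. Qed.

(** The disjunctions rule out new segments shorter than m at both ends of the
    window: either the window reaches the neighbouring entry, and there is
    nothing to insert, or it stays at distance at least m from it. *)
Lemma window_contrast s1 r s2 t m : rcons tau n.+1 = s1 ++ r :: s2 ->
  let p := last 1%N s1 in
  (0 < m)%N -> (p + m == t)%N || (p + 2 * m <= t)%N ->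
  (t + m == r)%N || (t + 2 * m <= r)%N ->
  noise_stat (theta + e) (t - m) t (t + m) ^+ 2 <=
  L * (3 * q + 8 * ln (n%:R / m%:R)).
Proof.
move=> E p m0 Hp Hr.
have [_ [p1 rn]] := adjacent_bounds n_gt0 tau_min (m := [::]) E.
have rn' : (r <= n.+1)%N by apply: rn; rewrite mem_head.
rewrite -/p in p1.
have pm : (p + m <= t)%N by lia.
have mr : (t + m <= r)%N by lia.
have [u [v [uE vE [pu ut tv vr] [utm vtm up_m rv_m]]]] : exists u v, [/\ u = (t - m)%N, v = (t + m)%N,
    [/\ (p <= u)%N, (u < t)%N, (t < v)%N & (v <= r)%N] &
    [/\ (t - u = m)%N, (v - t = m)%N, (p < u)%N -> (m <= u - p)%N & (v < r)%N -> (m <= r - v)%N]].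
  by exists (t - m)%N, (t + m)%N; split=> //; split; lia.
have [mn mrp] : (m <= n)%N /\ (m <= r - p)%N by lia.
have [rpn upn rvn] : [/\ (r - p <= n)%N, (u - p <= n)%N & (r - v <= n)%N] by split; lia.
rewrite -uE -vE {Hp Hr pm mr uE vE}.
have ur : (u <= r)%N by exact: ltnW (leq_trans (ltn_trans ut tv) vr).
have uv : (u < v)%N by exact: ltn_trans ut tv.
pose Y := theta + e; rewrite -/Y.
pose cst a b := seg_cost L q Y a b.
(* The point u = t - m (resp. v = t + m) is inserted unless it is already
   an entry. *)
pose stubL := if (p < u)%N then [:: u] else [::].
pose stubR := if (v < r)%N then [:: v] else [::].
have N0 : 0 < n%:R :> R by rewrite ltr0n.
have lnm a : (m <= a)%N -> (a <= n)%N -> 0 <= ln (n%:R / a%:R : R) <= ln (n%:R / m%:R).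
  move=> ma an; have a0 : (0 < a)%N by apply: leq_trans ma.
  rewrite ln_ge0 ?ler_pdivlMr ?ltr0n// ?mul1r ?ler_nat//=.
  by rewrite ler_ln ?posrE ?divr_gt0 ?ltr0n// ler_pM2l// lef_pV2 ?posrE ?ltr0n// ler_nat.
set l := ln (n%:R / m%:R) in lnm *.
have l0 : 0 <= l by have /andP[] := lnm m (leqnn _) mn.
have pen_ge0 : 0 <= L * (q + 2 * l) by rewrite mulr_ge0// addr_ge0// mulr_ge0.
have cst_le a b : (m <= b - a)%N -> (b - a <= n)%N -> cst a b <= rss Y a b + L * (q + 2 * l).
  move=> h1 h2; rewrite lerD2l ler_wpM2l// lerD2l ler_pM2l//.
  by case/andP: (lnm _ h1 h2).
have costL : path_cost cst p (stubL ++ [:: t]) <= rss Y p u + cst u t + L * (q + 2 * l).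
  rewrite /stubL; case: ifP => h /=; rewrite addr0.
    by rewrite [leRHS]addrAC lerD2r; apply: cst_le => //; exact: up_m.
  have -> : p = u by apply/eqP; rewrite eqn_leq pu leqNgt h.
  by rewrite rss_nil add0r lerDl.
have costR : path_cost cst t (rcons stubR r) <= rss Y v r + cst t v + L * (q + 2 * l).
  rewrite /stubR; case: ifP => h /=; rewrite addr0.
    by rewrite [leLHS]addrC [leRHS]addrAC lerD2r; apply: cst_le => //; exact: rv_m.
  have -> : r = v by apply/eqP; rewrite eqn_leq vr andbT leqNgt h.
  by rewrite rss_nil add0r lerDl.
have := @local_minimality R n n_gt0 L q Y tau s1 [::] (stubL ++ t :: stubR) r s2 tau_min E.
rewrite -/p -/cst.
have -> : rcons (stubL ++ t :: stubR) r = (stubL ++ [:: t]) ++ rcons stubR r.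
  by rewrite -catA rcons_cat.
rewrite path_cost_cat last_cat /= addr0.
have pth : path ltn p ((stubL ++ [:: t]) ++ rcons stubR r).
  have pt : (p < t)%N := leq_ltn_trans pu ut.
  have tr : (t < r)%N := leq_trans tv vr.
  by rewrite /stubL /stubR; case: ifP => h1; case: ifP => h2 /=; rewrite ?h1 ?h2 ?ut ?tv ?pt ?tr.
move=> /(_ pth) H.
have K1 : rss Y p u + rss Y u r <= rss Y p r by apply: rss_super; rewrite pu.
have K2 : rss Y u v + rss Y v r <= rss Y u r by apply: rss_super; rewrite (ltnW uv).
have utv : (u < t < v)%N by rewrite ut.
have K3 := rss_split Y utv.
have cu : cst u t = rss Y u t + L * (q + 2 * l) by rewrite /cst /seg_cost utm.
have cv : cst t v = rss Y t v + L * (q + 2 * l) by rewrite /cst /seg_cost vtm.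
have cp : rss Y p r + L * q <= cst p r.
  rewrite /cst /seg_cost lerD2l ler_wpM2l// lerDl mulr_ge0//.
  by have /andP[] := lnm (r - p)%N mrp rpn.
move: H costL costR; rewrite cu cv; move: (path_cost _ _ _) (path_cost _ _ _) => A B.
by rewrite /cst in cp; lra.
Qed.

Lemma window_jump s1 r s2 t m m1 m2 : rcons tau n.+1 = s1 ++ r :: s2 ->
  let p := last 1%N s1 in
  (0 < m)%N -> (p + m == t)%N || (p + 2 * m <= t)%N ->
  (t + m == r)%N || (t + 2 * m <= r)%N ->
  plateau theta (t - m) t m1 -> plateau theta t (t + m) m2 ->
  (m2 - m1) ^+ 2 * m%:R <= 32 * (L + 1) * (q + ln (n%:R / m%:R)).
Proof.
move=> E p m0 Hp Hr P1 P2.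
have H := window_contrast E m0 Hp Hr.
have [_ [p1 rn]] := adjacent_bounds n_gt0 tau_min (m := [::]) E.
have rn' : (r <= n.+1)%N by apply: rn; rewrite mem_head.
rewrite -/p in p1.
have pm : (p + m <= t)%N by lia.
have mr : (t + m <= r)%N by lia.
have utv : (t - m < t < t + m)%N by lia.
have vn : (t + m <= n.+1)%N by lia.
have u1 : (1 <= t - m)%N by lia.
have [e1 [e2 [e3 [wn mn]]]] : (t - (t - m) = m)%N /\ (t + m - t = m)%N /\
  (t + m - (t - m) = 2 * m)%N /\ (2 * m <= n)%N /\ (m <= n)%N by lia.
have M0 : 0 < m%:R :> R by rewrite ltr0n.
have N0 : 0 < n%:R :> R by rewrite ltr0n.
have c2 := @noise_stat_close _ _ q theta e noise_le _ _ _ u1 utv vn.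
have l0 : 0 <= ln (n%:R / m%:R : R).
  by rewrite ln_ge0// ler_pdivlMr// mul1r ler_nat.
apply: (window_energy L_ge0 _ l0 (sqrtr_ge0 _) c2 H).
- by move: q_ge; lra.
- have [-> _] := @log_threshold_sqr R n q _ _ _ q0 utv ltac:(by rewrite e3).
  rewrite e1 e2 e3.
  have -> : ln (n%:R / m%:R) = ln (n%:R / (2 * m)%N%:R) + ln 2 :> R.
    rewrite -lnM ?posrE ?divr_gt0 ?ltr0n ?muln_gt0//; congr ln.
    by rewrite natrM; field; rewrite gt_eqF.
  have := @ln2_le1 R.
  by lra.
- rewrite (plateau_contrast utv P1 P2).
  rewrite e1 e2 e3.
  by rewrite natrM; field; rewrite gt_eqF.
Qed.

End Detection.

(** If x = 1 the window must reach the neighbour, otherwise half the distance is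
    a safe size.  Unless m is capped by l or r, 3 m recovers x or y in both cases. *)
Lemma window_size x y l r : (0 < x)%N -> (0 < y)%N -> (0 < l)%N -> (0 < r)%N ->
  exists m, [/\ (0 < m)%N, (m <= l)%N /\ (m <= r)%N,
    (m == x) || (2 * m <= x)%N, (m == y) || (2 * m <= y)%N &
    [|| x <= 3 * m, y <= 3 * m, l <= m | r <= m]%N].
Proof.
move=> x0 y0 l0 r0.
exists (minn (minn (maxn 1 (x %/ 2)) (maxn 1 (y %/ 2))) (minn l r)).
by split; lia.
Qed.

Section HighEnergy.
Context (R : realType).

Lemma dH1_le (tau : seq nat) t s (D : R) : s \in tau -> `|s%:R - t%:R| <= D ->
  (dH1 R tau t <= D%:E)%E.
Proof.
rewrite /dH1; elim: tau => [//|x tau IH]; rewrite inE big_cons => /orP[/eqP <-|st] sD.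
  by rewrite ge_min lee_fin sD.
by rewrite ge_min IH ?orbT.
Qed.

Lemma ln_ratio_le (N h m : R) : 0 < m -> 0 < h -> 0 < N -> h <= 6 * m ->
  ln (N / m) <= ln (N / h) + 5.
Proof.
move=> m0 h0 N0 hm.
have : ln (N / m) <= ln (N / h * 6).
  rewrite ler_ln ?posrE ?mulr_gt0 ?invr_gt0// -mulrA ler_pM2l// mulrC.
  by rewrite ler_pdivlMr// mulrC ler_pdivrMr// mulrC.
rewrite [ln (N / h * 6)]lnM ?posrE ?divr_gt0// => h1; apply: (le_trans h1); rewrite lerD2l.
have := @le_ln1Dx R 5; rewrite (_ : 1 + 5 = 6); last by lra.
by apply; lra.
Qed.

(** z is the squared jump and h the distance to one of the adjacent true
    change-points.  A window of size comparable to h is incompatible with the high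
    energy, whose constant (12 C) ^ 2 exceeds that of the window bound. *)
Lemma window_vs_energy (C q z N h m : R) :
  1 <= C -> 5 <= q -> 0 <= z -> 0 < m -> 0 < h -> h <= N -> h <= 6 * m ->
  (12 * C) ^+ 2 * (q + 2 * ln (N / h)) < z * h ->
  z * m <= C * (q + ln (N / m)) -> False.
Proof.
move=> C1 q5 z0 m0 h0 hN hm E J.
have N0 : 0 < N by exact: lt_le_trans hN.
have l0 : 0 <= ln (N / h) by apply: ln_ge0; rewrite ler_pdivlMr// mul1r.
have lm := ln_ratio_le m0 h0 N0 hm.
move: (ln (N / h)) (ln (N / m)) l0 lm E J => l l' l0 lm E J.
have C0 : 0 <= C by lra.
have h1 : z * h <= 6 * (z * m) by have := ler_wpM2l z0 hm; lra.
have h2 : C * (q + l') <= C * (2 * q + l) by apply: ler_wpM2l => //; lra.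
have h3 : 0 <= C * (q + l) by apply: mulr_ge0 => //; lra.
have h4 := ler_wpM2r h3 C1.
have h5 : 0 <= C * C * l by rewrite !mulr_ge0.
have h6 := mulr_ge0 C0 l0.
have h7 : 0 <= C * q by apply: mulr_ge0 => //; lra.
by lra.
Qed.

Lemma energy_rate_gt0 (C q z N h : R) :
  1 <= C -> 5 <= q -> 0 <= z -> 0 < h -> h <= N ->
  (12 * C) ^+ 2 * (q + 2 * ln (N / h)) < z * h -> 0 < z /\ 0 <= ln (N * z).
Proof.
move=> C1 q5 z0 h0 hN E.
have l0 : 0 <= ln (N / h) by apply: ln_ge0; rewrite ler_pdivlMr// mul1r.
have zh : 1 <= z * h.
  apply: ltW; apply: le_lt_trans E.
  have h1 : 1 <= (12 * C) ^+ 2 by rewrite expr_ge1//; lra.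
  have h2 : 1 <= q + 2 * ln (N / h) by lra.
  by have := ler_pM ler01 ler01 h1 h2; rewrite mulr1.
have zp : 0 < z.
  by rewrite lt_neqAle z0 andbT; apply: contraTneq zh => <-; rewrite mul0r -ltNge ltr01.
have Nz : 1 <= N * z by apply: (le_trans zh); rewrite mulrC ler_pM2r.
by split=> //; exact: ln_ge0.
Qed.

(** High energy makes N z large; hence N / m <= N z, and the window bound is of
    the order of the rate, with a smaller constant. *)
Lemma window_vs_rate (C q z N h m : R) :
  1 <= C -> 5 <= q -> 0 <= z -> 0 < m -> 0 < h -> h <= N ->
  (12 * C) ^+ 2 * (q + 2 * ln (N / h)) < z * h ->
  12 * C * ((ln (N * z) + q) / z) <= 3 * m ->
  z * m <= C * (q + ln (N / m)) -> False.
Proof.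
move=> C1 q5 z0 m0 h0 hN E Dm J.
have N0 : 0 < N by exact: lt_le_trans hN.
have l0 : 0 <= ln (N / h) by apply: ln_ge0; rewrite ler_pdivlMr// mul1r.
have [zp lNz] := energy_rate_gt0 C1 q5 z0 h0 hN E.
have zm : 12 * C * (ln (N * z) + q) <= 3 * (z * m).
  have := ler_wpM2l z0 Dm; rewrite [leLHS]mulrC -!mulrA mulVf ?gt_eqF// mulr1.
  by lra.
have C0 : 0 <= C by lra.
have Cq : 5 <= C * q by have := ler_pM ler01 (le_trans ler01 (ltac:(lra) : 1 <= q)) C1 (lexx q); lra.
have Cl := mulr_ge0 C0 lNz.
have zm1 : 1 <= z * m by lra.
have lm : ln (N / m) <= ln (N * z).
  rewrite ler_ln ?posrE ?mulr_gt0 ?invr_gt0// ler_pM2l//.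
  by rewrite -[m^-1]mul1r ler_pdivrMr.
have : C * (q + ln (N / m)) <= C * (q + ln (N * z)).
  by apply: ler_wpM2l => //; rewrite lerD2l.
by lra.
Qed.

Context (n : nat) (n_gt0 : (0 < n)%N).
Variables (L q : R) (theta e : 'rV[R]_n) (tau : seq nat).
Hypothesis q_ge : 5 * 60 <= q.
Hypothesis L_ge0 : 0 <= L.
Hypothesis noise_le : forall t1 t2 t3, in_T3 n t1 t2 t3 ->
  `|noise_stat e t1 t2 t3| <= 2 * log_threshold n q t1 t2 t3.
Hypothesis tau_min : is_pls_estimate L q (theta + e) tau.
Variables (K : nat) (taus : seq nat) (mu : nat -> R).
Hypothesis thetaP : in_Theta K theta taus mu.
Let q0 : 0 <= q. Proof. by move: q_ge; lra. Qed.

Let C := 32 * (L + 1).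

Lemma high_energy_jump k : (1 <= k <= K)%N -> high_energy theta (12 * C) q taus k ->
  let l := (cpt n taus k - cpt n taus k.-1)%N in
  let r := (cpt n taus k.+1 - cpt n taus k)%N in
  (12 * C) ^+ 2 * (q + 2 * ln (n%:R / l%:R)) < jump mu k ^+ 2 * l%:R /\
  (12 * C) ^+ 2 * (q + 2 * ln (n%:R / r%:R)) < jump mu k ^+ 2 * r%:R.
Proof.
move=> kK he; have stu := true_lt n_gt0 thetaP kK.
have [tP _ _ _] := thetaP.
have k1 : (1 <= k <= K.+1)%N by case/andP: kK => -> /leqW ->.
have kS : (1 <= k.+1 <= K.+1)%N by rewrite ltnS; case/andP: kK.
have P1 := theta_plateau n_gt0 thetaP k1.
have P2 := theta_plateau n_gt0 thetaP kS.
have s1 := cpt_ge1 n_gt0 tP k.-1.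
have un := cpt_max n_gt0 tP k.+1.
move: he; rewrite /high_energy energyE /=.
move: (cpt n taus k.-1) (cpt n taus k) (cpt n taus k.+1) stu P1 P2 s1 un => s t u stu P1 P2 s1 un he.
have [usn uE] : (u - s <= n)%N /\ (u - s = (t - s) + (u - t))%N by lia.
have [_ [_ T1 T2]] := log_threshold_sqr q0 stu usn.
have T0 : 0 <= log_threshold n q s t u := sqrtr_ge0 _.
have C0 : 0 <= 12 * C by rewrite /C; move: L_ge0; lra.
have : (12 * C * log_threshold n q s t u) ^+ 2 < noise_stat theta s t u ^+ 2.
  have CT := mulr_ge0 C0 T0.
  rewrite -[ltRHS]real_normK ?num_real//.
  by rewrite !expr2; apply: ltr_pM.
rewrite (plateau_contrast stu P1 P2) exprMn -/(jump mu k).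
move/andP: stu => [st tu].
have l0 : 0 < (t - s)%N%:R :> R by rewrite ltr0n subn_gt0.
have r0 : 0 < (u - t)%N%:R :> R by rewrite ltr0n subn_gt0.
rewrite uE natrD => he2.
split.
- apply: (@le_lt_trans _ _ ((12 * C) ^+ 2 * log_threshold n q s t u ^+ 2)).
    by apply: ler_wpM2l; [exact: sqr_ge0|rewrite addrC].
  apply: (lt_le_trans he2); apply: ler_wpM2l; first exact: sqr_ge0.
  by rewrite ler_pdivrMr ?addr_gt0// ler_pM2l// lerDr ltW.
- apply: (@le_lt_trans _ _ ((12 * C) ^+ 2 * log_threshold n q s t u ^+ 2)).
    by apply: ler_wpM2l; [exact: sqr_ge0|rewrite addrC].
  apply: (lt_le_trans he2); apply: ler_wpM2l; first exact: sqr_ge0.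
  by rewrite ler_pdivrMr ?addr_gt0// mulrC ler_pM2l// lerDl ltW.
Qed.

(** Let D be the claimed distance and suppose that every entry is farther.  Then
    both neighbouring entries, or the boundary, are at distance at least D, which
    makes room for a window of size at least D / 3. *)
Lemma high_energy_detected k : (1 <= k <= K)%N -> high_energy theta (12 * C) q taus k ->
  (dH1 R tau (cpt n taus k) <=
     (Num.min ((cpt n taus k.+1 - cpt n taus k)%N%:R / 2)
     (Num.min ((cpt n taus k - cpt n taus k.-1)%N%:R / 2)
       (12 * C * ((ln (n%:R * jump mu k ^+ 2) + q) / jump mu k ^+ 2))))%:E)%E.
Proof.
move=> kK he; have [hl hr] := high_energy_jump kK he.
have stu := true_lt n_gt0 thetaP kK; have /andP[st tu] := stu.
have [tP _ _ _] := thetaP.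
set D := Num.min _ _.
rewrite leNgt; apply/negP => far.
have {}far x : x \in tau -> D < `|x%:R - (cpt n taus k)%:R|.
  move=> xt; rewrite ltNge; apply/negP => xD.
  by move: far; rewrite ltNge (dH1_le xt xD).
have C1 : 1 <= C by rewrite /C; move: L_ge0; lra.
have q5 : 5 <= q by move: q_ge; lra.
have z0 : 0 <= jump mu k ^+ 2 by exact: sqr_ge0.
have N0 : 0 < n%:R :> R by rewrite ltr0n.
have k1 : (1 <= k <= K.+1)%N by case/andP: kK => -> /leqW ->.
have kS : (1 <= k.+1 <= K.+1)%N by rewrite ltnS; case/andP: kK.
have P1 := theta_plateau n_gt0 thetaP k1.
have P2 := theta_plateau n_gt0 thetaP kS.
have s_ge1 := cpt_ge1 n_gt0 tP k.-1.
have u_le := cpt_max n_gt0 tP k.+1.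
set rate := 12 * C * _ in D far.
have D_r : D <= (cpt n taus k.+1 - cpt n taus k)%N%:R / 2 by rewrite /D ge_min lexx.
have D_l : D <= (cpt n taus k - cpt n taus k.-1)%N%:R / 2 by rewrite /D !ge_min lexx orbT.
have D_cases : [\/ D = (cpt n taus k.+1 - cpt n taus k)%N%:R / 2,
   D = (cpt n taus k - cpt n taus k.-1)%N%:R / 2 | D = rate].
  rewrite /D /Num.min; case: ifP => _; first by constructor 1.
  by case: ifP => _; [constructor 2|constructor 3].
have tn : cpt n taus k \notin tau.
  apply/negP => /far; rewrite subrr normr0 ltNge; apply/negP/negPn.
  rewrite /D !le_min !divr_ge0//= /rate mulr_ge0 ?divr_ge0//; first by move: C1; lra.
  have l0 : 0 < (cpt n taus k - cpt n taus k.-1)%N%:R :> R by rewrite ltr0n subn_gt0.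
  have lN : (cpt n taus k - cpt n taus k.-1)%N%:R <= n%:R :> R.
    by rewrite ler_nat; move: s_ge1 stu u_le; clear; lia.
  by rewrite addr_ge0//; case: (energy_rate_gt0 C1 q5 z0 l0 lN hl).
have [s1 [r' [s2 [E h p_in r_in]]]] := gap_around_missing (true_range n_gt0 thetaP kK) tn.
have J := window_jump n_gt0 q_ge L_ge0 noise_le tau_min E.
have [_ [p1 rn]] := adjacent_bounds n_gt0 tau_min (m := [::]) E.
have r'n : (r' <= n.+1)%N by apply: rn; rewrite mem_head.
move: (last 1%N s1) h p_in J p1 => p h p_in J p1.
move: hl hr stu st tu P1 P2 s_ge1 u_le D_r D_l D_cases tn far J h.
rewrite /=; move: (cpt n taus k.-1) (cpt n taus k) (cpt n taus k.+1) => s t u.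
move=> hl hr stu st tu P1 P2 s_ge1 u_le D_r D_l D_cases tn far J /andP[pt tr].
have x0 : (0 < t - p)%N by rewrite subn_gt0.
have y0 : (0 < r' - t)%N by rewrite subn_gt0.
have l0 : (0 < t - s)%N by rewrite subn_gt0.
have r0 : (0 < u - t)%N by rewrite subn_gt0.
have [m [m0 [ml mr] mx my mbig]] := window_size x0 y0 l0 r0.
have [mp mr'] : (p + m == t)%N || (p + 2 * m <= t)%N /\
    (t + m == r')%N || (t + 2 * m <= r')%N.
  by move: pt tr mx my; clear; lia.
have [tm tm'] : (s <= t - m)%N /\ (t + m <= u)%N.
  by move: st tu ml mr; clear; lia.
have {J} J := J t m (mu k) (mu k.+1) m0 mp mr' (plateau_sub tm (leqnn _) P1) (plateau_sub (leqnn _) tm' P2).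
rewrite -/(jump mu k) -/C in J.
have D_p : D <= (t - p)%N%:R.
  move: p_in; rewrite inE => /orP[/eqP pE|/far/ltW].
    apply: (le_trans D_l); rewrite ler_pdivrMr// -natrM ler_nat pE.
    by move: s_ge1 st; clear; lia.
  by rewrite distrC ger0_norm ?subr_ge0 ?ler_nat ?(ltnW pt)// natrB// ltnW.
have D_r' : D <= (r' - t)%N%:R.
  move: r_in; rewrite mem_rcons inE => /orP[/eqP rE|/far/ltW].
    apply: (le_trans D_r); rewrite ler_pdivrMr// -natrM ler_nat rE.
    by move: u_le tu; clear; lia.
  by rewrite ger0_norm ?subr_ge0 ?ler_nat ?(ltnW tr)// natrB// ltnW.
have M0 : 0 < m%:R :> R by rewrite ltr0n.
have L0' : 0 < (t - s)%N%:R :> R by rewrite ltr0n subn_gt0.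
have R0' : 0 < (u - t)%N%:R :> R by rewrite ltr0n subn_gt0.
have LN : (t - s)%N%:R <= n%:R :> R.
  by rewrite ler_nat; move: s_ge1 st tu u_le; clear; lia.
have RN : (u - t)%N%:R <= n%:R :> R.
  by rewrite ler_nat; move: s_ge1 st tu u_le; clear; lia.
have D_m : D <= 3 * m%:R.
  case/or4P: mbig; rewrite -(ler_nat R) ?natrM => h; lra.
case: D_cases => DE.
- by apply: (window_vs_energy C1 q5 z0 M0 R0' RN _ hr J); lra.
- by apply: (window_vs_energy C1 q5 z0 M0 L0' LN _ hl J); lra.
- by rewrite DE in D_m; exact: (window_vs_rate C1 q5 z0 M0 L0' LN hl D_m J).
Qed.

End HighEnergy.

(** * The theorem *)

Theorem proposition7 (R : realType) :
  exists (c c' L0 q0 : R) (n0 : nat),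
    [/\ 0 < c, 0 < c', 0 < L0, 0 < q0 & (0 < n0)%N] /\
    forall L : R, L0 <= L ->
    exists kappaL : R, 0 < kappaL /\
    forall (q : R) (n : nat), q0 < q -> (n0 < n)%N ->
    forall (d : measure_display) (T : measurableType d) (P : probability T R)
      (eps : 'I_n -> {RV P >-> R}), subgaussian_noise eps ->
    forall (K : nat) (theta : 'rV[R]_n) (taus : seq nat) (mu : nat -> R),
      (0 < K)%N -> in_Theta K theta taus mu ->
    ((1 - c * expR (- (c' * q)))%:E < P (eventA eps q))%E /\
    forall w : T, eventA eps q w ->
    forall tauhat : seq nat,
      is_pls_estimate L q (theta + noise_vec eps w) tauhat ->
    [/\
      [/\ forall k : nat, (2 <= k <= K.-1)%N ->
            (count_in tauhat
               `](midpoint R (cpt n taus k.-1) (cpt n taus k)),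
                 (midpoint R (cpt n taus k) (cpt n taus k.+1))] <= 1)%N,
          (count_in tauhat
             `[2%:R, (midpoint R (cpt n taus 1) (cpt n taus 2))] <= 1)%N
        & (count_in tauhat
             `](midpoint R (cpt n taus K.-1) (cpt n taus K)), n%:R] <= 1)%N],

      forall k : nat, (1 <= k <= K)%N -> high_energy theta kappaL q taus k ->
        (dH1 R tauhat (cpt n taus k) <=
           (Num.min ((cpt n taus k.+1 - cpt n taus k)%N%:R / 2)
           (Num.min ((cpt n taus k - cpt n taus k.-1)%N%:R / 2)
                    (kappaL * ((ln (n%:R * jump mu k ^+ 2) + q)
                               / jump mu k ^+ 2))))%:E)%E
    & forall k : nat, (1 <= k <= K)%N ->
        let tau' := insert_cpt tauhat (cpt n taus k) in
        cpt n taus k \in tauhat \/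
        ~~ high_energy theta (Num.sqrt L + 2) q tau'
             (index (cpt n taus k) tau').+1 ].
Proof.
(* 2 ^ s is the ratio between the length of an increment and the mesh to which
   chaining rounds its ends. *)
have [s [s_le s_big]] : exists s : nat, (s <= 14)%N /\ 16 * 16 * 64 <= (2 ^ s)%N%:R :> R.
  by exists 14%N; split=> //; rewrite natrX; lra.
have [K0 [K0_gt0 K0_ge]] : exists K0 : R, 0 < K0 /\ 4 * 81 <= K0.
  by exists (4 * 81); split; lra.
exists (8 * (2 ^ s.+1)%N%:R + 1), (3 / 4), (K0 ^+ 2), (5 * 60), 1%N; split.
  split; last by [].
  - by have := ler0n R (2 ^ s.+1); lra.
  - by lra.
  - by rewrite exprn_gt0.
  - by lra.
move=> L L_ge; exists (12 * (32 * (L + 1))).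
have L0 : 0 <= L by apply: le_trans L_ge; exact: sqr_ge0.
split; first by lra.
move=> q n q_gt n_gt d T P eps sg K theta taus mu Kpos thetaP.
have q_ge := ltW q_gt; have n_gt0 := ltnW n_gt.
split; first exact: eventA_prob.
move=> w Aw tauhat tau_min.
split.
- exact: (no_spurious n_gt0 q_ge K0_ge L_ge Aw tau_min thetaP Kpos).
- move=> k kK he; exact: (high_energy_detected n_gt0 q_ge L0 Aw tau_min thetaP kK he).
- move=> k kK; exact: (undetected_not_high_energy n_gt0 q_ge L0 Aw tau_min thetaP kK).
Qed.
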